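(* There is a certifying algorithm that runs in time $O(|V|+|E|)$ to test whether an input split graph $G=(V,E)$ has a star $4$-coloring.
   Context: Graphs are finite, with no loops or parallel edges. A star coloring of $G$ is a proper vertex coloring in which no path on four vertices (as a not necessarily induced subgraph) uses only two colors; a star $k$-coloring is a star coloring using at most $k$ colors. A split graph is a graph whose vertex set can be partitioned into a clique $K$ and an independent set $S$. A recognition algorithm is certifying if, besides a yes/no answer, it returns a certificate allowing the user to verify the answer. Here a yes-certificate is a star $4$-coloring of $G$, and a no-certificate is an induced subgraph of $G$ isomorphic to one of $K_5,G_1,\dots,G_5$, where each $G_i$ is the split graph with clique $\{1,2,3,4\}$ and an independent set having exactly one vertex for each listed neighborhood: $G_1$: $\{1,2,3\},\{4\}$; $G_2$: $\{1,2,3\},\{3,4\}$; $G_3$: $\{1,2,3\},\{2,3,4\}$; $G_4$: $\{1,2\},\{3,4\}$; $G_5$: $\{1\},\{2,3\},\{2,4\},\{3,4\}$. *)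

(* Defs.v *)
From mathcomp Require Import all_boot.

Set Implicit Arguments.
Unset Strict Implicit.
Unset Printing Implicit Defensive.

(* A graph on the finite type [T] is a symmetric irreflexive [e : rel T]. *)

Definition edges (T : finType) (e : rel T) : {set {set T}} :=
  [set [set p.1; p.2] | p : T * T & e p.1 p.2].

Definition clique (T : finType) (e : rel T) (K : {set T}) : Prop :=
  {in K &, forall x y, x != y -> e x y}.

Definition independent (T : finType) (e : rel T) (S : {set T}) : Prop :=
  {in S &, forall x y, ~~ e x y}.

Definition split_graph (T : finType) (e : rel T) : Prop :=
  exists K S : {set T},
    [/\ K :|: S = [set: T], [disjoint K & S], clique e K & independent e S].

(* The path [a b c d] need not be induced. *)
Definition star_coloring (T C : finType) (e : rel T) (f : T -> C) : Prop :=
  (forall x y, e x y -> f x != f y) /\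
  (forall a b c d, uniq [:: a; b; c; d] -> e a b -> e b c -> e c d ->
     2 < #|[set f a; f b; f c; f d]|).

Definition star_colorable (T : finType) (e : rel T) (k : nat) : Prop :=
  exists f : T -> 'I_k, star_coloring e f.

Definition isomorphic (T1 T2 : finType) (e1 : rel T1) (e2 : rel T2) : Prop :=
  exists2 f : T1 -> T2, bijective f & {mono f : x y / e1 x y >-> e2 x y}.

Definition induced (T : finType) (e : rel T) (W : {set T}) :
    rel {x : T | x \in W} :=
  fun x y => e (val x) (val y).
Arguments induced {T} e W.

Definition complete (n : nat) : rel 'I_n := fun x y => x != y.
Arguments complete n : clear implicits.

(* The split graph with clique {1,2,3,4} and one further vertex for each entry
   of [N], adjacent to the clique vertices listed in that entry.  Clique vertex
   [k] is represented by the ordinal of value [k - 1]. *)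
Definition split4 (N : seq (seq nat)) : rel ('I_4 + 'I_(size N)) :=
  fun x y => match x, y with
  | inl i, inl j => i != j
  | inl i, inr s | inr s, inl i => (val i).+1 \in nth [::] N s
  | inr _, inr _ => false
  end.
Arguments split4 N : clear implicits.

Definition G1 := split4 [:: [:: 1; 2; 3]; [:: 4]].
Definition G2 := split4 [:: [:: 1; 2; 3]; [:: 3; 4]].
Definition G3 := split4 [:: [:: 1; 2; 3]; [:: 2; 3; 4]].
Definition G4 := split4 [:: [:: 1; 2]; [:: 3; 4]].
Definition G5 := split4 [:: [:: 1]; [:: 2; 3]; [:: 2; 4]; [:: 3; 4]].

Definition forbidden (T : finType) (e : rel T) (W : {set T}) : Prop :=
  let H := induced e W in
  isomorphic H (complete 5) \/ isomorphic H G1 \/ isomorphic H G2 \/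
  isomorphic H G3 \/ isomorphic H G4 \/ isomorphic H G5.

(* A program uses finitely many registers and finitely many arrays of
    registers; arrays are addressed indirectly and every elementary operation
    costs one unit.  The only arithmetic operations are successor and
    (truncated) predecessor, so after [t] steps every stored number exceeds
    the largest number of the input and of the program text by at most [t]:
    a linear-time computation only manipulates words of logarithmic length,
    and the unit cost measure hides no computation on large numbers. *)

Inductive expr : Type :=
  | Const of nat
  | Var of nat
  | Get of nat & expr
  | Succ of expr
  | Pred of expr.

Inductive test : Type :=
  | Eq of expr & expr
  | Lt of expr & expr
  | Not of test
  | And of test & test.

Inductive cmd : Type :=
  | Skip
  | Assign of nat & expr
  | Put of nat & expr & expr
  | Seq of cmd & cmd
  | If of test & cmd & cmd
  | While of test & cmd.

Record store : Type := Store { reg : nat -> nat; arr : nat -> nat -> nat }.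

Definition set_reg (s : store) (x v : nat) : store :=
  Store (fun y => if y == x then v else reg s y) (arr s).

Definition set_arr (s : store) (a i v : nat) : store :=
  Store (reg s)
        (fun b j => if (b == a) && (j == i) then v else arr s b j).

Fixpoint eval (s : store) (x : expr) : nat :=
  match x with
  | Const k => k
  | Var y => reg s y
  | Get a i => arr s a (eval s i)
  | Succ y => (eval s y).+1
  | Pred y => (eval s y).-1
  end.

Fixpoint holds (s : store) (b : test) : bool :=
  match b with
  | Eq x y => eval s x == eval s y
  | Lt x y => eval s x < eval s y
  | Not c => ~~ holds s c
  | And c d => holds s c && holds s d
  end.

Fixpoint expr_cost (x : expr) : nat :=
  match x with
  | Const _ | Var _ => 1
  | Get _ y | Succ y | Pred y => (expr_cost y).+1
  end.

Fixpoint test_cost (b : test) : nat :=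
  match b with
  | Eq x y | Lt x y => (expr_cost x + expr_cost y).+1
  | Not c => (test_cost c).+1
  | And c d => (test_cost c + test_cost d).+1
  end.

(* [exec P s t s']: started in [s], the program [P] halts in [s'] after
   exactly [t] steps. *)
Inductive exec : cmd -> store -> nat -> store -> Prop :=
  | ExecSkip s : exec Skip s 1 s
  | ExecAssign s x v :
      exec (Assign x v) s (expr_cost v).+1 (set_reg s x (eval s v))
  | ExecPut s a i v :
      exec (Put a i v) s (expr_cost i + expr_cost v).+1
           (set_arr s a (eval s i) (eval s v))
  | ExecSeq P Q s1 s2 s3 t u :
      exec P s1 t s2 -> exec Q s2 u s3 -> exec (Seq P Q) s1 (t + u) s3
  | ExecIfTrue b P Q s s' t :
      holds s b -> exec P s t s' -> exec (If b P Q) s (test_cost b + t) s'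
  | ExecIfFalse b P Q s s' t :
      ~~ holds s b -> exec Q s t s' -> exec (If b P Q) s (test_cost b + t) s'
  | ExecWhileTrue b P s1 s2 s3 t u :
      holds s1 b -> exec P s1 t s2 -> exec (While b P) s2 u s3 ->
      exec (While b P) s1 (test_cost b + t + u) s3
  | ExecWhileFalse b P s :
      ~~ holds s b -> exec (While b P) s (test_cost b) s.

Lemma exec_det P s t s' :
  exec P s t s' -> forall u s'', exec P s u s'' -> u = t /\ s'' = s'.
Proof.
elim=> {P s t s'} *;
  match goal with H : exec _ _ _ _ |- _ = _ /\ _ => inversion H end; subst;
  repeat match goal with
  | IH : forall u s, exec ?P ?s0 u s -> _, H : exec ?P ?s0 _ _ |- _ =>
      case: (IH _ _ H) => ? ?; subst; clear H
  | H : is_true (holds ?s ?b), K : is_true (~~ holds ?s ?b) |- _ =>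
      by rewrite H in K
  end; by [].
Qed.

(* Each neighborhood is listed without repetition, in an arbitrary order. *)
Definition adjacency_lists (n : nat) (e : rel 'I_n) (adj : 'I_n -> seq 'I_n) :
    Prop :=
  forall v, uniq (adj v) /\ (forall w, (w \in adj v) = e v w).

(* Register 0 holds the number of vertices.  Array 1 holds the concatenation of
   the adjacency lists; the list of vertex [v] occupies the positions from
   [arr 0 v] (included) to [arr 0 v.+1] (excluded).  All other cells are 0. *)
Definition input (n : nat) (adj : 'I_n -> seq 'I_n) : store :=
  let lists := [seq [seq val w | w <- adj v] | v <- enum 'I_n] in
  let offsets := mkseq (fun v => size (flatten (take v lists))) n.+1 in
  Store (fun x => if x == 0 then n else 0)
        (fun a i => match a with
                    | 0 => nth 0 offsets i
                    | 1 => nth 0 (flatten lists) i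
                    | _ => 0
                    end).

Definition answer (s : store) : nat := reg s 1.

(* A yes-certificate is the table, in array 2, of a star 4-coloring with colors
   0, ..., 3. *)
Definition yes_certificate (n : nat) (e : rel 'I_n) (s : store) : Prop :=
  exists2 f : 'I_n -> 'I_4, star_coloring e f & forall v : 'I_n, arr s 2 v = f v.

(* A no-certificate is the list, in array 2 with its length in register 2, of
   the vertices of a forbidden induced subgraph, each listed once. *)
Definition no_certificate (n : nat) (e : rel 'I_n) (s : store) : Prop :=
  exists2 W : {set 'I_n}, forbidden e W &
    perm_eq (mkseq (arr s 2) (reg s 2)) [seq val v | v <- enum W].

Definition certified_answer (n : nat) (e : rel 'I_n) (s : store) : Prop :=
  [/\ answer s = 1, star_colorable e 4 & yes_certificate e s] \/
  [/\ answer s = 0, ~ star_colorable e 4 & no_certificate e s].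

(* Main.v *)
From mathcomp Require Import all_boot zify.
Require Import Defs.

Set Implicit Arguments.
Unset Strict Implicit.
Unset Printing Implicit Defensive.

(** Let [K], [S] be a split partition of the graph.

    Degrees find the clique.  Take vertices [a_0, a_1, ...] in decreasing order
    of degree.  If the first [k + 1] of them have degree at least [k], they form
    a clique ([leading_clique]); if every vertex but the first [k] has degree
    less than [k], the others are independent ([leading_independent]).  So
    either [a_0, ..., a_4] is a [K_5], or [a_0, ..., a_3] is a clique whose
    complement is independent, or already the complement of [a_0, a_1, a_2] is
    independent.  In this last case three private colors for [a_0, a_1, a_2] and
    a fourth one for all the others give a star coloring: a bicolored path on
    four vertices repeats both its colors.

    There remains a clique [a_0, ..., a_3] with an independent complement, in
    which all degrees are at most 3.  A proper 4-coloring gives each outer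
    vertex [u] the color of a core vertex [a_c] not adjacent to [u].  Draw an
    arc from [c] to [d] for every neighbor [a_d] of [u].  A bicolored path on
    four vertices must be [u - a_d - a_c - w], with [u] colored like [a_c] and
    [w] like [a_d]; it exists exactly when both arcs between [c] and [d] are
    drawn.  Hence a star coloring amounts to an orientation of (part of) the
    complete graph on the four colors in which the neighborhood of every outer
    vertex is dominated by a single color outside of it.  Only the set of
    neighborhoods that occur matters: there are 15 possible ones, and whatever
    set of them occurs, either one of the five forbidden configurations appears
    or one of eight orientations works ([obstruction_or_orientation]).  By hand:
    if some [{1,2,3}] occurs, the absence of the first three configurations
    forces all neighborhoods into [{1,2,3}], and color 4 dominates them.
    Otherwise the absence of the fourth one forces the pairs to have a common
    element, where the cyclic orientation of [wheel] works, or to form a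
    triangle [{2,3}, {2,4}, {3,4}], where the absence of the fifth one lets
    color 1 dominate everything as in [fan].

    The program counts degrees, selects five vertices of largest degree by five
    scans, and in the main case gives each outer vertex the code of its
    neighborhood, keeps one representative per code, and runs through a fixed
    list of configurations and orientations.  All of its loops are single scans
    with a loop-free body, so that its running time is at most a constant, read
    off its text ([weight]), times one more than the number of vertices plus the
    total length of the adjacency lists ([runs_for], [runs_linear]). *)

(** * Degrees in split graphs *)

Lemma split_nbr_subset (T : finType) (e : rel T) (K S : {set T}) s :
  K :|: S = [set: T] -> independent e S -> s \in S -> e s \subset K.
Proof.
move=> KS iS sS; apply/subsetP=> x; rewrite unfold_in => esx.
have := in_setT x; rewrite -KS inE => /orP[//|xS].
by case/negP: (iS s x sS xS).
Qed.

(** A vertex of the independent side with at least [#|K|] neighbors sees all of [K],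
    because its neighborhood lies in [K]. *)
Lemma split_nbr_all (T : finType) (e : rel T) (K S : {set T}) s x :
  K :|: S = [set: T] -> independent e S -> s \in S -> #|K| <= #|e s| ->
  x \in K -> e s x.
Proof.
move=> KS iS sS leK xK; have sub := split_nbr_subset KS iS sS.
have /(_ x) := subset_cardP (anti_leq (introT andP (conj (subset_leq_card sub) leK))) sub.
by rewrite xK.
Qed.

(** The lower bound on degrees of clique vertices that drives the two lemmas
    below: besides [K] minus itself, [x] sees all of [X]. *)
Lemma split_clique_degree (T : finType) (e : rel T) (K S X : {set T}) x :
  [disjoint K & S] -> clique e K -> x \in K -> X \subset S ->
  {in X, forall s, e x s} -> #|K| + #|X| <= #|e x|.+1.
Proof.
move=> dKS cK xK XS eX.
have dis : (K :\ x) :&: X = set0.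
  apply/setP=> y; rewrite !inE; apply/negP=> /andP[/andP[_ yK] yX].
  by have := disjointFr dKS yK; rewrite (subsetP XS).
have : #|(K :\ x) :|: X| <= #|e x|.
  apply/subset_leq_card/subsetP=> y; rewrite !inE => /orP[/andP[yx yK]|yX].
    by apply: cK => //; rewrite eq_sym.
  exact: eX.
by rewrite cardsU dis cards0 subn0 (cardsD1 x K) xK; lia.
Qed.

(** Suppose that [a], [b] in [A] are not adjacent, with [a] in [S].  Its degree
    forces [a] to have a neighbor [x] outside of [A], which lies in [K] and has
    degree at least [#|K|], so [a] and [b], being ranked before [x], see all of
    [K].  Then both are neighbors of [x] in [S], and [x] has degree larger than
    [#|K|], which bounds the degree of [a]. *)
Lemma leading_clique (T : finType) (e : rel T) (A : {set T}) :
  symmetric e -> irreflexive e -> split_graph e ->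
  (forall a b, a \in A -> b \notin A -> #|e b| <= #|e a|) ->
  (forall a, a \in A -> #|A| <= #|e a|.+1) -> clique e A.
Proof.
move=> eC eI [K [S [KS dKS cK iS]]] top big a b aA bA ab.
apply/negPn/negP=> nab.
wlog: a b aA bA ab nab / a \in S => [IH|aS].
  have := in_setT a; have := in_setT b; rewrite -KS !inE.
  case/orP=> [bK|bS]; last by move=> _; apply: (IH b a); rewrite // 1?eq_sym // eC.
  case/orP=> [aK|]; last exact: (IH a b).
  by case/negP: nab; apply: cK.
(* Otherwise the neighbors of [a] would all be in [A] minus [a] and [b]. *)
have [x eax xA] : exists2 x, e a x & x \notin A.
  apply/exists_inP; apply: contraT; rewrite negb_exists_in => /forall_inP nx.
  have : e a \subset A :\ a :\ b.
    apply/subsetP=> y eay; rewrite !inE (negPn (nx _ eay)) andbT.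
    apply/andP; split; apply/eqP=> yE; move: eay; rewrite yE unfold_in ?eI //.
    by rewrite (negPf nab).
  move/subset_leq_card; have := big a aA.
  by rewrite (cardsD1 a A) aA (cardsD1 b (A :\ a)) !inE eq_sym ab bA /=; lia.
have xK : x \in K by apply: (subsetP (split_nbr_subset KS iS aS)).
have ltK s : s \in S -> #|e s| <= #|K|.
  by move=> sS; apply/subset_leq_card/(split_nbr_subset KS iS sS).
have degx : #|K| <= #|e x|.
  have := @split_clique_degree _ e K S [set a] x dKS cK xK.
  rewrite sub1set cards1 addn1 ltnS; apply=> // s /set1P->.
  by rewrite eC.
have bS : b \in S.
  have := in_setT b; rewrite -KS inE => /orP[bK|//].
  case/negP: nab; apply: (split_nbr_all KS iS aS _ bK).
  exact: leq_trans degx (top _ _ aA xA).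
have ebx : e b x.
  apply: (split_nbr_all KS iS bS _ xK); exact: leq_trans degx (top _ _ bA xA).
have := @split_clique_degree _ e K S [set a; b] x dKS cK xK.
rewrite cards2 ab subUset !sub1set aS bS => /(_ isT) H.
suff /H : {in [set a; b], forall s, e x s}.
  by have := top _ _ aA xA; have := ltK a aS; lia.
by move=> s; rewrite !inE eC => /orP[] /eqP->.
Qed.

(** Suppose that [b], [c] outside of [A] are adjacent, with [b] in [K].  Every
    [s] in [A] and [S] has a degree at least that of [b] and of [c], which
    forces it to see [b].  Hence
    [#|K| + #|A :&: S| <= #|e b|.+1 <= #|A|], that is [#|K| <= #|A :&: K|],
    although [b] is in [K] and not in [A]. *)
Lemma leading_independent (T : finType) (e : rel T) (A : {set T}) :
  symmetric e -> irreflexive e -> split_graph e ->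
  (forall a b, a \in A -> b \notin A -> #|e b| <= #|e a|) ->
  (forall b, b \notin A -> #|e b| < #|A|) -> independent e (~: A).
Proof.
move=> eC eI [K [S [KS dKS cK iS]]] top small b c.
rewrite !inE => bA cA; apply/negP=> ebc.
wlog: b c bA cA ebc / b \in K => [IH|bK].
  have := in_setT b; rewrite -KS inE => /orP[bK|bS]; first exact: (IH b c).
  apply: (IH c b) => //; first by rewrite eC.
  exact: (subsetP (split_nbr_subset KS iS bS)).
have adj s : s \in A :&: S -> e b s.
  rewrite inE eC => /andP[sA sS].
  have := in_setT c; rewrite -KS inE => /orP[cK'|cS]; last first.
    apply: (split_nbr_all KS iS sS _ bK); apply: leq_trans (top _ _ sA bA).
    have := @split_clique_degree _ e K S [set c] b dKS cK bK.
    by rewrite sub1set cards1 addn1 ltnS; apply=> // _ /set1P->.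
  have bc : b != c by apply: contraTneq ebc => ->; rewrite eI.
  (* A vertex [s] that misses both [b] and [c] has fewer neighbors than [b]. *)
  have [y [yK yA esy]] : exists y, [/\ y \in K, y \notin A & e s y].
    case sb: (e s b); first by exists b.
    case sc: (e s c); first by exists c.
    have : e s \subset K :\ b :\ c.
      apply/subsetP=> y esy; rewrite !inE (subsetP (split_nbr_subset KS iS sS)) //.
      rewrite andbT; apply/andP; split; apply/eqP=> yE; move: esy.
        by rewrite yE unfold_in sc.
      by rewrite yE unfold_in sb.
    move/subset_leq_card; have := top _ _ sA bA.
    have := @split_clique_degree _ e K S set0 b dKS cK bK.
    rewrite sub0set cards0 (cardsD1 b K) bK (cardsD1 c (K :\ b)) !inE.
    rewrite eq_sym bc cK' /= => /(_ isT) H1; suff : {in set0, forall s0, e b s0}.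
      by move/H1; lia.
    by move=> z; rewrite inE.
  apply: (split_nbr_all KS iS sS _ bK); apply: leq_trans (top _ _ sA yA).
  have := @split_clique_degree _ e K S [set s] y dKS cK yK.
  rewrite sub1set cards1 addn1 ltnS; apply=> // _ /set1P->.
  by rewrite eC.
have := split_clique_degree dKS cK bK (subsetIr A S) adj.
have AKS : #|A| <= #|A :&: K| + #|A :&: S|.
  by rewrite -{1}[A]setIT -KS setIUr cardsU leq_subr.
have : #|A :&: K| < #|K|.
  rewrite (cardsD1 b K) bK add1n ltnS; apply/subset_leq_card/subsetP=> y.
  rewrite !inE => /andP[yA ->]; rewrite andbT.
  by apply: contraTneq yA => ->.
by have := small b bA; lia.
Qed.

(** * Star colorings and the forbidden configurations *)

Lemma card_two_colors (C : finType) (p q : C) : #|[set p; q; p; q]| <= 2.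
Proof.
have -> : [set p; q; p; q] = [set p; q].
  by apply/setP=> x; rewrite !inE; do 2!case: (x == _).
by rewrite cards2; case: (p != q).
Qed.

(** Two vertices of the same color are not both in [K], and each edge meets [K].
    So a bicolored path on four vertices has its ends outside of [K] and its
    middle edge inside, which is the pattern excluded by the last hypothesis. *)
Lemma star_coloring_from_core (T C : finType) (e : rel T) (f : T -> C)
    (K : {set T}) :
  independent e (~: K) -> {in K &, injective f} ->
  (forall x y, e x y -> f x != f y) ->
  (forall u x y w, u \notin K -> w \notin K -> x \in K -> y \in K ->
     e u y -> e x w -> f u = f x -> f w = f y -> False) ->
  star_coloring e f.
Proof.
move=> iS injf proper noarc; split=> // a b c d uabcd eab ebc ecd.
have cover x y : e x y -> (x \in K) || (y \in K).
  move=> exy; apply/negPn/negP; rewrite negb_or => /andP[xK yK].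
  by have := iS x y; rewrite !inE xK yK exy => /(_ isT isT).
have noK (x y : T) : x != y -> f x = f y -> ~~ ((x \in K) && (y \in K)).
  by move=> xy fxy; apply: contra xy => /andP[xK yK]; apply/eqP/injf.
have card3 x y z : x != y -> y != z -> x != z -> 2 < #|[set x; y; z] : {set C}|.
  move=> xy yz xz; rewrite cardsU cards2 cards1 xy.
  suff -> : [set x; y] :&: [set z] = set0 by rewrite cards0.
  apply/setP=> t; rewrite !inE; apply/negP=> /andP[/orP[]/eqP-> /eqP tz].
    by rewrite tz eqxx in xz.
  by rewrite tz eqxx in yz.
have [fac|fac] := eqVneq (f a) (f c); last first.
  apply: leq_trans (card3 _ _ _ (proper _ _ eab) (proper _ _ ebc) fac) _.
  by apply/subset_leq_card/subsetP=> t; rewrite !inE => /orP[/orP[]|]->; rewrite ?orbT.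
have [fbd|fbd] := eqVneq (f b) (f d); last first.
  apply: leq_trans (card3 _ _ _ (proper _ _ ebc) (proper _ _ ecd) fbd) _.
  by apply/subset_leq_card/subsetP=> t; rewrite !inE => /orP[/orP[]|]->; rewrite ?orbT.
(* Both colors are repeated; find out which vertices are in [K]. *)
exfalso; move: uabcd; rewrite /= !inE !negb_or.
case/and4P=> /and3P[_ ac _] /andP[_ bd] _ _.
have := noK _ _ ac fac; have := noK _ _ bd fbd.
have := cover _ _ eab; have := cover _ _ ebc; have := cover _ _ ecd.
case aK: (a \in K); case bK: (b \in K); case cK: (c \in K) => //;
  case dK: (d \in K) => // _ _ _ _ _.
by apply: (noarc a c b d); rewrite ?aK ?dK.
Qed.

Lemma star_coloring_embed (T1 T2 C : finType) (e1 : rel T1) (e2 : rel T2)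
    (h : T1 -> T2) (f : T2 -> C) :
  injective h -> (forall x y, e1 x y -> e2 (h x) (h y)) ->
  star_coloring e2 f -> star_coloring e1 (f \o h).
Proof.
move=> injh homh [proper path]; split=> [x y /homh/proper //|a b c d u ab bc cd].
apply: path; try exact: homh.
by rewrite -[uniq _]/(uniq (map h [:: a; b; c; d])) map_inj_uniq.
Qed.

Fixpoint words k : seq (seq nat) :=
  if k is k'.+1 then [seq c :: w | c <- iota 0 4, w <- words k'] else [:: [::]].

Lemma mem_words w : all (fun c => c < 4) w -> w \in words (size w).
Proof.
elim: w => // c w IH /andP[c4 /IH w4].
have: c \in iota 0 4 by rewrite mem_iota.
by move=> cin; apply: allpairs_f.
Qed.

(** [w] lists, for each vertex of the independent set, the clique vertex of the
    same color.  With [i = j] the condition says that the coloring is proper,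
    with [i != j] that no bicolored path joins the two vertices. *)
Definition clash_free (N : seq (seq nat)) (w : seq nat) :=
  all (fun i => all (fun j =>
    ~~ (((nth 0 w j).+1 \in nth [::] N i) && ((nth 0 w i).+1 \in nth [::] N j)))
    (iota 0 (size N))) (iota 0 (size N)).

(** The clique uses all four colors, so each other vertex shares its color with
    exactly one clique vertex, and only [4 ^ size N] cases are left. *)
Lemma split4_not_colorable N :
  ~~ has (clash_free N) (words (size N)) -> ~ star_colorable (split4 N) 4.
Proof.
move/hasPn=> none [f [proper path]].
have injf : injective (f \o inl).
  move=> i j /= fij; apply/eqP/negPn/negP=> ij.
  by have := proper (inl i) (inl j) ij; rewrite fij eqxx.
have [g _ fg] := injF_bij injf.
(* [k j] is the clique vertex with the color of the vertex [j]. *)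
pose k (j : 'I_(size N)) := g (f (inr j)).
have fk j : f (inl (k j)) = f (inr j) by exact: (fg (f (inr j))).
pose w := [seq val (k j) | j <- enum 'I_(size N)].
have sw : size w = size N by rewrite size_map size_enum_ord.
have wk (j : 'I_(size N)) : nth 0 w j = k j.
  by rewrite (nth_map j) ?size_enum_ord // nth_ord_enum.
have : w \in words (size N).
  by rewrite -sw; apply: mem_words; apply/allP=> _ /mapP[j _ ->]; apply: ltn_ord.
move/none/negP; apply; apply/allP=> i; rewrite mem_iota => /andP[_ ltis].
apply/allP=> j; rewrite mem_iota => /andP[_ ltjs].
rewrite add0n in ltis ltjs.
rewrite (wk (Ordinal ltis)) (wk (Ordinal ltjs)).
set i' := Ordinal ltis; set j' := Ordinal ltjs.
apply/negP=> /andP[ji ij].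
have kij : k i' != k j'.
  apply: contraTneq ji => kij; rewrite -kij; apply/negP=> ii.
  by have := proper (inr i') (inl (k i')) ii; rewrite fk eqxx.
have := @path (inr i') (inl (k j')) (inl (k i')) (inr j').
rewrite !fk ltnNge card_two_colors.
suff u : uniq [:: inr i'; inl (k j'); inl (k i'); inr j' : 'I_4 + 'I_(size N)].
  by move/(_ u ji); rewrite eq_sym in kij; move/(_ kij ij).
have ll : (inl (k j') == inl (k i') :> 'I_4 + 'I_(size N)) = false.
  by apply: contraNF kij => /eqP[->].
have rr : (inr i' == inr j' :> 'I_4 + 'I_(size N)) = false.
  by apply: contraNF kij => /eqP[ij']; rewrite (_ : i' = j') //; apply: val_inj.
by rewrite /= !inE ll rr.
Qed.

Definition configurations : seq (seq (seq nat)) :=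
  [:: [:: [:: 1; 2; 3]; [:: 4]];
      [:: [:: 1; 2; 3]; [:: 3; 4]];
      [:: [:: 1; 2; 3]; [:: 2; 3; 4]];
      [:: [:: 1; 2]; [:: 3; 4]];
      [:: [:: 1]; [:: 2; 3]; [:: 2; 4]; [:: 3; 4]]].

Lemma forbidden_configuration (T : finType) (e : rel T) (W : {set T}) N :
  N \in configurations -> isomorphic (induced e W) (split4 N) -> forbidden e W.
Proof.
rewrite /forbidden !inE => /orP[/eqP->|/orP[/eqP->|/orP[/eqP->|/orP[/eqP->|/eqP->]]]].
all: by tauto.
Qed.

Lemma forbidden_not_colorable (T : finType) (e : rel T) (W : {set T}) :
  forbidden e W -> ~ star_colorable e 4.
Proof.
move=> forb [f starf].
have transfer (T2 : finType) (e2 : rel T2) :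
    isomorphic (induced e W) e2 -> star_colorable e2 4.
  case=> h [g hg gh] mono; exists (f \o (val \o g)).
  apply: star_coloring_embed starf; first exact: inj_comp val_inj (can_inj gh).
  by move=> x y; rewrite -{1}[x]gh -{1}[y]gh mono.
case: forb => [/transfer[c [proper _]]|forb].
  have /leq_card : injective c.
    move=> x y cxy; apply/eqP/negPn/negP=> xy.
    by have := proper x y xy; rewrite cxy eqxx.
  by rewrite !card_ord.
have none : all (fun N => ~~ has (clash_free N) (words (size N))) configurations.
  by [].
have [N inN] : exists2 N, N \in configurations & isomorphic (induced e W) (split4 N).
  by case: forb => [|[|[|[|]]]]; eexists; try eassumption; rewrite !inE eqxx ?orbT.
by move/transfer; apply: split4_not_colorable; apply: (allP none).
Qed.

(** Gives induced subgraphs by listing their vertices, without building an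
    isomorphism from the subtype. *)
Lemma isomorphic_image (T1 T2 : finType) (e1 : rel T1) (e2 : rel T2)
    (h : T1 -> T2) :
  injective h -> {mono h : x y / e1 x y >-> e2 x y} ->
  isomorphic (induced e2 (h @: setT)) e1.
Proof.
move=> injh monoh.
pose h' x : {y | y \in h @: setT} := Sub (h x) (imset_f h (in_setT x)).
have injh' : injective h' by move=> x y /(congr1 val) /= /injh.
have card' : #|{: {y | y \in h @: setT}}| <= #|T1|.
  by rewrite card_sig card_imset // cardsT.
have [g h'g gh'] := inj_card_bij injh' card'.
by exists g; [exists h'|move=> x y; rewrite -monoh -{2}[x]gh' -{2}[y]gh'].
Qed.

(** * Neighborhood types and the choice between obstruction and coloring *)

Definition bit (k t : nat) := odd (iter k half t).

(** The adjacency of a vertex, determined by codes: [16 + k] for the [k]-th core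
    vertex, and for an outer vertex the number below 16 whose binary digits say
    which core vertices are its neighbors. *)
Definition code_adj (c d : nat) : bool :=
  if 16 <= c then (if 16 <= d then c != d else bit (c - 16) d)
  else (16 <= d) && bit (d - 16) c.

(** The codes of a copy of the configuration [N] in which the clique vertices
    1, ..., 4 are the core vertices with indices [s]. *)
Definition placement (N : seq (seq nat)) (s : seq nat) : seq nat :=
  [seq 16 + k | k <- s] ++
  [seq sumn [seq 2 ^ nth 0 s k.-1 | k <- B] | B <- N].

(** [split4 N] transported to the numbers below [4 + size N], along [unsplit]. *)
Definition split4_nat (N : seq (seq nat)) (x y : nat) : bool :=
  if x < 4 then (if y < 4 then x != y else x.+1 \in nth [::] N (y - 4))
  else (y < 4) && (y.+1 \in nth [::] N (x - 4)).

Lemma split4_unsplit N (x y : 'I_4 + 'I_(size N)) :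
  split4 N x y = split4_nat N (unsplit x) (unsplit y).
Proof.
by case: x y => [i|i] [j|j]; rewrite /split4_nat /= ?ltn_ord ?addKn.
Qed.

Definition clique_orders := permutations (iota 0 4).

Definition well_placed N (L : seq nat) :=
  [&& size L == 4 + size N, uniq L, all (fun c => c < 20) L &
      all (fun i => all (fun j =>
        code_adj (nth 0 L i) (nth 0 L j) == split4_nat N i j)
      (iota 0 (4 + size N))) (iota 0 (4 + size N))].

Lemma all_well_placed N s :
  N \in configurations -> s \in clique_orders -> well_placed N (placement N s).
Proof.
move=> Nin sin.
suff /allP/(_ N Nin)/allP/(_ s sin) :
  all (fun N => all (fun s => well_placed N (placement N s)) clique_orders)
      configurations by [].
by vm_compute.
Qed.

(** When adjacency is a function of codes, vertices with the right codes span a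
    forbidden subgraph: distinct codes make them distinct. *)
Lemma forbidden_placement (T : finType) (e : rel T) (code : T -> nat)
    (N : seq (seq nat)) (L : seq nat) (r : 'I_(4 + size N) -> T) :
  (forall u v, e u v = code_adj (code u) (code v)) ->
  N \in configurations -> well_placed N L ->
  (forall i, code (r i) = nth 0 L i) -> injective r /\ forbidden e (r @: setT).
Proof.
move=> eE Nin /and4P[/eqP sL uL _ adj] rL.
have injr : injective r.
  move=> i j rij; apply/val_inj/eqP; rewrite -(nth_uniq 0 _ _ uL) ?sL ?ltn_ord //=.
  by rewrite -!rL rij.
split=> //; apply: (forbidden_configuration Nin).
have uK : cancel (@unsplit 4 (size N)) (@split 4 (size N)) by exact: unsplitK.
have -> : r @: setT = (r \o @unsplit 4 (size N)) @: setT.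
  apply/setP=> v; apply/imsetP/imsetP=> -[i _ ->]; last by exists (unsplit i).
  by exists (split i); rewrite //= splitK.
apply: isomorphic_image; first exact: inj_comp injr (can_inj uK).
move=> x y /=; rewrite eE !rL split4_unsplit; apply/eqP.
have mi (i : 'I_(4 + size N)) : (i : nat) \in iota 0 (4 + size N).
  by rewrite mem_iota ltn_ord.
exact: (allP (allP adj _ (mi (unsplit x))) _ (mi (unsplit y))).
Qed.

Definition fan (s : seq nat) : seq (nat * nat) :=
  let a := nth 0 s in [:: (a 0, a 1); (a 0, a 2); (a 0, a 3)].

(** Suited to pairs that all contain [s_0]: the other element of the pair is
    dominated by its predecessor in the cyclic part, which dominates [s_0] too. *)
Definition wheel (s : seq nat) : seq (nat * nat) :=
  let a := nth 0 s in
  [:: (a 1, a 2); (a 2, a 3); (a 3, a 1); (a 1, a 0); (a 2, a 0); (a 3, a 0)].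

Definition orientations : seq (seq (nat * nat)) :=
  let rotations := [seq rot k (iota 0 4) | k <- iota 0 4] in
  map fan rotations ++ map wheel rotations.

(** The value 4, which [find] returns on failure, stands for the absence of a color
    that dominates [t]. *)
Definition color_of (o : seq (nat * nat)) (t : nat) : nat :=
  find (fun c => all (fun d => bit d t ==> ((c, d) \in o)) (iota 0 4)) (iota 0 4).

Lemma color_of_le o t : color_of o t <= 4.
Proof. exact: find_size. Qed.

Lemma color_ofP o t d :
  color_of o t < 4 -> d < 4 -> bit d t -> (color_of o t, d) \in o.
Proof.
move=> c4 d4 bd.
have /(nth_find 0) : has (fun c => all (fun d => bit d t ==> ((c, d) \in o)) (iota 0 4))
  (iota 0 4) by rewrite has_find.
rewrite -/(color_of o t) nth_iota // add0n => /allP/(_ d).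
by rewrite mem_iota bd => /(_ d4).
Qed.

(** No pair of opposite arcs belongs to an orientation, so colors chosen by
    domination create no bicolored path, nor (for [t1 = t2]) an improper edge. *)
Lemma color_of_clash o t1 t2 : o \in orientations ->
  color_of o t1 < 4 -> color_of o t2 < 4 ->
  bit (color_of o t2) t1 -> bit (color_of o t1) t2 -> False.
Proof.
move=> oin c1 c2 b1 b2.
have asym : all (fun o => all (fun p => (p.2, p.1) \notin o) o) orientations by [].
have /negP := allP (allP asym o oin) _ (color_ofP c1 c2 b1); apply.
exact: color_ofP c2 c1 b2.
Qed.

(** [(v, b)] asserts that the variable [v] has the value [b]. *)
Definition literal := (nat * bool)%type.

Definition assign (v : nat) (b : bool) (dnf : seq (seq literal)) :=
  [seq [seq l <- m | l.1 != v] | m <- dnf & all (fun l => (l.1 == v) ==> (l.2 == b)) m].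

(** Shannon expansion with pruning: a branch stops as soon as one conjunction of
    the disjunctive normal form is satisfied. *)
Fixpoint tautology (vars : seq nat) (dnf : seq (seq literal)) : bool :=
  has (@nilp _) dnf ||
  if vars is v :: vars' then
    tautology vars' (assign v true dnf) && tautology vars' (assign v false dnf)
  else false.

Lemma tautologyP vars dnf (p : nat -> bool) :
  tautology vars dnf -> has (all (fun l : literal => p l.1 == l.2)) dnf.
Proof.
have base d : has (@nilp _) d -> has (all (fun l : literal => p l.1 == l.2)) d.
  by case/hasP=> -[|//] d0 _; apply/hasP; exists [::].
elim: vars dnf => [|v vars IH] dnf /=; first by rewrite orbF; exact: base.
case/orP=> [/base //|taut].
have /IH/hasP[_ /mapP[m mdnf ->] sat] : tautology vars (assign v (p v) dnf).
  by case: (p v) taut => /andP[].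
move: mdnf; rewrite mem_filter => /andP[/allP cons mdnf].
apply/hasP; exists m => //; apply/allP=> l lm.
have [lv|lv] := eqVneq l.1 v.
  by have := cons l lm; rewrite lv eqxx eq_sym.
by move/allP: sat; apply; rewrite mem_filter lv.
Qed.

Definition presence (N : seq (seq nat)) (s : seq nat) : seq literal :=
  [seq (t, true) | t <- drop 4 (placement N s)].

Definition absence (o : seq (nat * nat)) : seq literal :=
  [seq (t, false) | t <- iota 0 15 & color_of o t == 4].

(** The heart of the classification, where [p t] tells whether the neighborhood
    [t] occurs among the outer vertices. *)
Lemma obstruction_or_orientation (p : nat -> bool) :
  has (all (fun l : literal => p l.1 == l.2))
    ([seq presence N s | N <- configurations, s <- clique_orders] ++
     [seq absence o | o <- orientations]).
Proof.
(* Triples, then pairs, then singletons: the order of the argument by hand,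
   which keeps the expansion small. *)
apply: (@tautologyP [:: 7; 11; 13; 14; 3; 12; 5; 10; 6; 9; 1; 2; 4; 8]).
by vm_compute.
Qed.

(** * Running times of structured programs *)

Fixpoint straight (P : cmd) : bool :=
  match P with
  | Skip | Assign _ _ | Put _ _ _ => true
  | Seq P Q | If _ P Q => straight P && straight Q
  | While _ _ => false
  end.

Fixpoint result (P : cmd) (s : store) : store :=
  match P with
  | Skip | While _ _ => s
  | Assign x v => set_reg s x (eval s v)
  | Put a i v => set_arr s a (eval s i) (eval s v)
  | Seq P Q => result Q (result P s)
  | If b P Q => if holds s b then result P s else result Q s
  end.

(** The constant of proportionality in the running time.  For a loop it covers one
    round and the final test, the number of rounds being counted elsewhere. *)
Fixpoint weight (P : cmd) : nat :=
  match P with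
  | Skip => 1
  | Assign _ v => (expr_cost v).+1
  | Put _ i v => (expr_cost i + expr_cost v).+1
  | Seq P Q => weight P + weight Q
  | If b P Q => test_cost b + (weight P + weight Q)
  | While b P => test_cost b + (test_cost b + weight P)
  end.

Lemma exec_straight P s : straight P ->
  exists2 t, exec P s t (result P s) & t <= weight P.
Proof.
elim: P s => //=.
- by move=> s _; exists 1 => //; constructor.
- by move=> x v s _; eexists; first constructor.
- by move=> a i v s _; eexists; first constructor.
- move=> P IHP Q IHQ s /andP[/(IHP s)[t1 e1 l1] /(IHQ (result P s))[t2 e2 l2]].
  by exists (t1 + t2); [econstructor; eassumption|lia].
move=> b P IHP Q IHQ s /andP[/(IHP s)[t1 e1 l1] /(IHQ s)[t2 e2 l2]].
case: ifP => hb; [exists (test_cost b + t1)|exists (test_cost b + t2)]; try lia.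
  exact: ExecIfTrue.
by apply: ExecIfFalse e2; rewrite hb.
Qed.

(** Total correctness with a time bound.  The bound is [M] times a constant that
    can be read off the text of the program, which makes the rules below
    compositional without computing any constant. *)
Definition runs (M : nat) (P : cmd) (s : store) (Q : store -> Prop) : Prop :=
  exists t s', [/\ exec P s t s', t <= weight P * M & Q s'].

Lemma runs_straight M P s (Q : store -> Prop) :
  0 < M -> straight P -> Q (result P s) -> runs M P s Q.
Proof.
move=> M0 /(exec_straight s)[t ex le] q; exists t, (result P s); split=> //.
by apply: leq_trans le _; rewrite leq_pmulr.
Qed.

Lemma runs_seq M P1 P2 s (Q R : store -> Prop) :
  runs M P1 s Q -> (forall s', Q s' -> runs M P2 s' R) -> runs M (Seq P1 P2) s R.
Proof.
case=> t1 [s1 [e1 l1 /[swap] /[apply]]] -[t2 [s2 [e2 l2 r]]].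
exists (t1 + t2), s2; split=> //; first exact: ExecSeq e1 e2.
by rewrite /= mulnDl leq_add.
Qed.

Lemma runs_if M b P1 P2 s (Q : store -> Prop) : 0 < M ->
  (if holds s b then runs M P1 s Q else runs M P2 s Q) -> runs M (If b P1 P2) s Q.
Proof.
move=> M0; case: ifP => hb [t [s' [ex le q]]]; exists (test_cost b + t), s';
  split=> //=; rewrite ?mulnDl.
- exact: ExecIfTrue.
- by rewrite leq_add ?leq_pmulr //; lia.
- by apply: ExecIfFalse ex; rewrite hb.
- by rewrite leq_add ?leq_pmulr //; lia.
Qed.

Lemma runs_weaken M P s (Q R : store -> Prop) :
  runs M P s Q -> (forall s', Q s' -> R s') -> runs M P s R.
Proof. by move=> [t [s' [ex le q]]] QR; exists t, s'; split=> //; apply: QR. Qed.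

Definition upto (x h : nat) (body : cmd) : cmd :=
  While (Lt (Var x) (Var h)) (Seq body (Assign x (Succ (Var x)))).

(** A loop whose body is loop-free makes at most [M] rounds of constant cost. *)
Lemma runs_upto M x h body lo hi s (I : nat -> store -> Prop) :
  0 < M -> straight body -> lo <= hi -> hi - lo <= M ->
  reg s x = lo -> reg s h = hi -> I lo s ->
  (forall i s', lo <= i < hi -> reg s' x = i -> reg s' h = hi -> I i s' ->
     let s'' := result body s' in
     [/\ reg s'' x = i, reg (set_reg s'' x i.+1) h = hi &
         I i.+1 (set_reg s'' x i.+1)]) ->
  runs M (upto x h body) s (I hi).
Proof.
move=> M0 str lohi bound sx sh I0 step.
set c := test_cost (Lt (Var x) (Var h)) +
  weight (Seq body (Assign x (Succ (Var x)))).
suff [t [s' [ex le q]]] : exists t s', [/\ exec (upto x h body) s t s',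
    t <= (hi - lo) * c + test_cost (Lt (Var x) (Var h)) & I hi s'].
  exists t, s'; split=> //; apply: leq_trans le _.
  rewrite [weight _]/= -/c mulnDl mulnC addnC.
  by rewrite leq_add ?leq_pmulr // leq_mul2l bound orbT.
have [k kE] : exists k, k = hi - lo by exists (hi - lo).
elim: k lo s lohi sx sh I0 step kE {bound} => [|k IH] lo s lohi sx sh I0 step kE.
  exists (test_cost (Lt (Var x) (Var h))), s; split; rewrite -?kE //.
    by apply: ExecWhileFalse; rewrite /= sx sh; lia.
  by have -> : hi = lo by lia.
have ltlo : lo < hi by lia.
have [|sx1 sh1 I1] := step lo s _ sx sh I0; first by rewrite leqnn.
have [t1 e1 l1] := exec_straight s str.
have [||||||t2 [s2 [e2 l2 q]]] := IH lo.+1 (set_reg (result body s) x lo.+1).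
- by [].
- by rewrite /= eqxx.
- by [].
- by [].
- by move=> i s' /andP[li ih]; apply: step; rewrite ih (ltnW li).
- lia.
exists (test_cost (Lt (Var x) (Var h)) + (t1 + 3) + t2), s2; split=> //.
  apply: ExecWhileTrue e2; first by rewrite /= sx sh.
  apply: ExecSeq e1 _.
  by have := ExecAssign (result body s) x (Succ (Var x)); rewrite /= sx1.
have -> : hi - lo = (hi - lo.+1).+1 by lia.
rewrite mulSn /c /=; move: l1 l2; rewrite /c /=; lia.
Qed.

Fixpoint written_regs (P : cmd) : seq nat :=
  match P with
  | Skip | Put _ _ _ => [::]
  | Assign x _ => [:: x]
  | Seq P Q | If _ P Q => written_regs P ++ written_regs Q
  | While _ P => written_regs P
  end.

Fixpoint written_arrs (P : cmd) : seq nat :=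
  match P with
  | Skip | Assign _ _ => [::]
  | Put a _ _ => [:: a]
  | Seq P Q | If _ P Q => written_arrs P ++ written_arrs Q
  | While _ P => written_arrs P
  end.

(** Frame condition, from the text of the program only. *)
Definition untouched (P : cmd) (s s' : store) : Prop :=
  (forall x, x \notin written_regs P -> reg s' x = reg s x) /\
  (forall a i, a \notin written_arrs P -> arr s' a i = arr s a i).

Lemma exec_untouched P s t s' : exec P s t s' -> untouched P s s'.
Proof.
elim=> {P s t s'} /=.
- by split.
- by move=> s x v; split=> //= y; rewrite inE => /negPf->.
- by move=> s a i v; split=> //= b j; rewrite inE => /negPf->.
- move=> P Q s1 s2 s3 t u _ [r1 a1] _ [r2 a2]; split=> [x|a i];
    rewrite mem_cat negb_or => /andP[n1 n2].
    by rewrite r2 // r1.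
  by rewrite a2 // a1.
- move=> b P Q s s' t _ _ [r1 a1]; split=> [x|a i];
    rewrite mem_cat negb_or => /andP[n1 n2]; [exact: r1|exact: a1].
- move=> b P Q s s' t _ _ [r1 a1]; split=> [x|a i];
    rewrite mem_cat negb_or => /andP[n1 n2]; [exact: r1|exact: a1].
- move=> b P s1 s2 s3 t u _ _ [r1 a1] _ [r2 a2]; split=> [x|a i] n.
    by rewrite r2 // r1.
  by rewrite a2 // a1.
- by split.
Qed.

Lemma runs_untouched M P s (Q : store -> Prop) :
  runs M P s Q -> runs M P s (fun s' => Q s' /\ untouched P s s').
Proof.
move=> [t [s' [ex le q]]]; exists t, s'; split=> //; split=> //.
exact: exec_untouched ex.
Qed.

(** In this form of the loop rule the counter, the bound and everything that the
    body does not write need not be part of the invariant. *)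
Lemma runs_for M x h body lo hi s (I : nat -> store -> Prop) :
  0 < M -> straight body ->
  x \notin written_regs body -> h \notin written_regs body -> h != x ->
  lo <= hi -> hi - lo <= M -> reg s x = lo -> reg s h = hi -> I lo s ->
  (forall i s', lo <= i < hi -> reg s' x = i -> untouched (upto x h body) s s' ->
     I i s' -> I i.+1 (set_reg (result body s') x i.+1)) ->
  runs M (upto x h body) s (fun s' => I hi s' /\ untouched (upto x h body) s s').
Proof.
move=> M0 str xb hb hx lohi bound sx sh I0 step; apply: runs_untouched.
apply: (runs_weaken (Q := fun s' => I hi s' /\ untouched (upto x h body) s s')).
  apply: (@runs_upto M x h body lo hi s
    (fun i s' => I i s' /\ untouched (upto x h body) s s')) => //.
  move=> i s' ihi s'x s'h [Ii unt] s''.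
  have [rs'' as''] : untouched body s' s''.
    by have [t ex _] := exec_straight s' str; apply: exec_untouched ex.
  split; first by rewrite rs''.
    by rewrite /= (negPf hx) rs''.
  split; first exact: step.
  case: unt => rs' as'; split=> [y|a j] /=.
    rewrite mem_cat inE negb_or => /andP[yb /negPf yx].
    by rewrite yx rs'' // rs' //= mem_cat inE negb_or yb yx.
  by rewrite cats0 => ab; rewrite as'' // as' //= cats0.
by move=> s' [].
Qed.

(** * The input arrays *)

Definition lists_of n (adj : 'I_n -> seq 'I_n) : seq (seq nat) :=
  [seq [seq val w | w <- adj v] | v <- enum 'I_n].

Definition offset n (adj : 'I_n -> seq 'I_n) (v : nat) : nat :=
  size (flatten (take v (lists_of adj))).

Lemma size_lists n (adj : 'I_n -> seq 'I_n) : size (lists_of adj) = n.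
Proof. by rewrite size_map size_enum_ord. Qed.

Lemma input_offset n (adj : 'I_n -> seq 'I_n) v :
  v <= n -> arr (input adj) 0 v = offset adj v.
Proof. by move=> vn; rewrite /= nth_mkseq ?ltnS. Qed.

Lemma offset_last n (adj : 'I_n -> seq 'I_n) :
  offset adj n = size (flatten (lists_of adj)).
Proof. by rewrite /offset take_oversize ?size_lists. Qed.

Lemma nth_lists n (adj : 'I_n -> seq 'I_n) (v : 'I_n) :
  nth [::] (lists_of adj) v = [seq val w | w <- adj v].
Proof. by rewrite (nth_map v) ?size_enum_ord // nth_ord_enum. Qed.

Lemma offsetS n (adj : 'I_n -> seq 'I_n) (v : 'I_n) :
  offset adj v.+1 = offset adj v + size (adj v).
Proof.
rewrite /offset (take_nth [::]) ?size_lists // -cats1 flatten_cat size_cat /=.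
by rewrite cats0 nth_lists size_map.
Qed.

Lemma nth_flatten_lists n (adj : 'I_n -> seq 'I_n) (v : 'I_n) i :
  i < size (adj v) ->
  nth 0 (flatten (lists_of adj)) (offset adj v + i) = nth 0 [seq val w | w <- adj v] i.
Proof.
move=> ilt; rewrite -[in LHS](cat_take_drop v (lists_of adj)) flatten_cat nth_cat.
rewrite ltnNge leq_addr /= addKn (drop_nth [::]) ?size_lists // nth_lists /=.
by rewrite nth_cat size_map ilt.
Qed.

Lemma count_adjacency n (e : rel 'I_n) adj (u v : 'I_n) :
  adjacency_lists e adj -> count_mem (val v) [seq val w | w <- adj u] = e u v.
Proof.
move=> /(_ u)[uu eu].
by rewrite count_uniq_mem ?(map_inj_uniq val_inj) // (mem_map val_inj) eu.
Qed.

(** By symmetry degrees can be counted by occurrences in the concatenated lists,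
    which needs no nested loop. *)
Lemma count_flatten_lists n (e : rel 'I_n) adj (v : 'I_n) :
  symmetric e -> adjacency_lists e adj ->
  count_mem (val v) (flatten (lists_of adj)) = #|e v|.
Proof.
move=> eC adjE; rewrite count_flatten -map_comp sumnE big_map.
rewrite big_enum -sum1_card [RHS]big_mkcond /=.
by apply: eq_big => // u _; rewrite (count_adjacency u v adjE) eC unfold_in; case: (e v u).
Qed.

(** Each pair of adjacent vertices is determined by its edge and by which of
    both orders it has, and there are two orders. *)
Lemma size_flatten_lists n (e : rel 'I_n) adj :
  irreflexive e -> adjacency_lists e adj ->
  size (flatten (lists_of adj)) <= 2 * #|edges e|.
Proof.
move=> eI adjE.
have -> : size (flatten (lists_of adj)) = #|[set p : 'I_n * 'I_n | e p.1 p.2]|.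
  rewrite size_flatten /shape -map_comp sumnE big_map big_enum /=.
  transitivity (\sum_(u : 'I_n) \sum_(v | e u v) 1).
    apply: eq_bigr => u _; have [uu eu] := adjE u.
    rewrite size_map sum1_card -(card_uniqP uu); apply: eq_card => w.
    by rewrite eu.
  by rewrite pair_big_dep /= sum1dep_card; apply: eq_card => p; rewrite !inE.
(* The boolean tells the order of the two ends. *)
pose g (p : 'I_n * 'I_n) := ([set p.1; p.2], val p.1 < val p.2).
rewrite -(card_in_imset (f := g)); last first.
  move=> [a b] [c d]; rewrite !inE /g /= => eab ecd [] /setP ab lt.
  have := ab a; have := ab b; rewrite !inE !eqxx orbT /=.
  have na : a != b by apply: contraTneq eab => ->; rewrite eI.
  have := ab c; rewrite !inE eqxx /= => ca.
  case/esym/orP=> /eqP bE; case/esym/orP=> /eqP aE.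
  - by rewrite aE bE eqxx in na.
  - by subst; exfalso; move: lt na; rewrite -val_eqE /=; lia.
  - by subst.
  - by rewrite aE bE eqxx in na.
have : g @: [set p | e p.1 p.2] \subset setX (edges e) [set: bool].
  apply/subsetP=> _ /imsetP[p pe ->]; rewrite !inE andbT /edges.
  by apply: imset_f; rewrite inE in pe *.
by move/subset_leq_card; rewrite cardsX cardsT card_bool mulnC.
Qed.

(** * Counting degrees and ranking the vertices *)

Notation "P ;; Q" := (Seq P Q) (at level 61, right associativity).

(** Memory layout, besides that of the input and the output: register 3 is the
    counter of every loop and register 4 the bound of the loops over a list;
    register 5 is the best candidate of a selection; registers 10 to 14 are the
    five selected vertices and registers 15 to 19 their keys.  Array 3 holds
    keys, array 4 codes, array 5 a representative (plus 1) of each code, and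
    array 6 the color of each code. *)
Definition for_vertices (body : cmd) : cmd := Assign 3 (Const 0);; upto 3 0 body.

Lemma runs_for_vertices M body n s (I : nat -> store -> Prop) :
  n < M -> straight body -> 3 \notin written_regs body ->
  0 \notin written_regs body -> reg s 0 = n -> I 0 (set_reg s 3 0) ->
  (forall i s', i < n -> reg s' 3 = i -> untouched (for_vertices body) s s' ->
     I i s' -> I i.+1 (set_reg (result body s') 3 i.+1)) ->
  runs M (for_vertices body) s
    (fun s' => I n s' /\ untouched (for_vertices body) s s').
Proof.
move=> nM str b3 b0 sn I0 step; apply: runs_untouched.
have M0 : 0 < M by lia.
apply: (runs_seq (Q := fun s' => s' = set_reg s 3 0)); first exact: runs_straight.
move=> _ ->; apply: (runs_weaken (Q := fun s' => I n s' /\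
   untouched (upto 3 0 body) (set_reg s 3 0) s')); last by move=> ? [].
apply: (@runs_for M 3 0 body 0 n) => //; first by lia.
move=> i s' /andP[_ ilt] s'3 [rs as_] Ii; apply: step => //; split=> [x|a j] /=.
  rewrite inE negb_or => /andP[x3 xb]; rewrite rs //= (negPf x3) //.
by move=> aj; rewrite as_.
Qed.

Definition count_degrees : cmd :=
  for_vertices (Put 3 (Var 3) (Const 1));;
  Assign 3 (Const 0);; Assign 4 (Get 0 (Var 0));;
  upto 3 4 (Put 3 (Get 1 (Var 3)) (Succ (Get 3 (Get 1 (Var 3))))).

Definition holds_graph n (adj : 'I_n -> seq 'I_n) (s : store) : Prop :=
  [/\ reg s 0 = n,
      forall v, v <= n -> arr s 0 v = offset adj v &
      forall i, arr s 1 i = nth 0 (flatten (lists_of adj)) i].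

Lemma holds_graph_untouched n (adj : 'I_n -> seq 'I_n) P s s' :
  0 \notin written_regs P -> 0 \notin written_arrs P -> 1 \notin written_arrs P ->
  untouched P s s' -> holds_graph adj s -> holds_graph adj s'.
Proof.
move=> r0 a0 a1 [rs as_] [h1 h2 h3]; split=> [|v vn|i].
- by rewrite rs.
- by rewrite as_ // h2.
- by rewrite as_ // h3.
Qed.

(** The degree plus 1 on vertices and 0 elsewhere, so that [n] can play the role
    of a missing vertex in selections. *)
Definition rank_key n (adj : 'I_n -> seq 'I_n) (v : nat) : nat :=
  (v < n) + count_mem v (flatten (lists_of adj)).

Lemma runs_count_degrees M n (adj : 'I_n -> seq 'I_n) s :
  n < M -> size (flatten (lists_of adj)) < M ->
  holds_graph adj s -> (forall v, arr s 3 v = 0) ->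
  runs M count_degrees s (fun s' =>
    (forall v, arr s' 3 v = rank_key adj v) /\ untouched count_degrees s s').
Proof.
move=> nM mM gs s3; apply: runs_untouched.
have M0 : 0 < M by lia.
apply: runs_seq.
  apply: (@runs_for_vertices _ _ n _ (fun i s' => forall v, arr s' 3 v = (v < i))) => //.
    by case: gs.
  move=> i s' _ s'3 _ Ii v /=; rewrite s'3 Ii; case: eqP => vi; lia.
move=> s1 [s13 /holds_graph_untouched/(_ gs) gs1].
set P := upto _ _ _; set flat := flatten _ in mM *.
pose s2 := set_reg (set_reg s1 3 0) 4 (size flat).
apply: (runs_seq (Q := fun s' => s' = set_reg s1 3 0)); first exact: runs_straight.
move=> _ ->; apply: (runs_seq (Q := fun s' => s' = s2)).
  apply: runs_straight => //; rewrite /= /s2; congr (set_reg _ _ _).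
  have [-> // off _] := gs1 isT isT isT; first by rewrite off // offset_last.
move=> _ ->; apply: (runs_weaken (Q := fun s' => (forall v, arr s' 3 v =
  (v < n) + count_mem v (take (size flat) flat)) /\ untouched P s2 s')).
  apply: (@runs_for _ 3 4 _ 0 (size flat) s2
    (fun i s' => forall v, arr s' 3 v = (v < n) + count_mem v (take i flat))) => //.
  - by lia.
  - by move=> v; rewrite take0 addn0 -s13.
  move=> i s' /andP[_ ilt] s'3 [rs as_] Ii v /=.
  have [_ _ h1] := gs1 isT isT isT.
  have -> : arr s' 1 (reg s' 3) = nth 0 flat i by rewrite s'3 as_ //= h1.
  rewrite (take_nth 0 ilt) -cats1 count_cat /= !Ii.
  rewrite [nth 0 flat i == v]eq_sym addn0.
  by case: eqP => [->|_] /=; rewrite ?addn0 // addn1 addnS.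
by move=> s' [h _] v; rewrite h take_size.
Qed.

(** The key of the selected vertex is erased, which excludes it from later
    selections. *)
Definition select (k : nat) : cmd :=
  Assign 5 (Var 0);;
  for_vertices (If (Lt (Get 3 (Var 5)) (Get 3 (Var 3))) (Assign 5 (Var 3)) Skip);;
  Assign (10 + k) (Var 5);; Assign (15 + k) (Get 3 (Var 5));;
  Put 3 (Var 5) (Const 0).

Lemma runs_select M k n s (F : nat -> nat) :
  n < M -> reg s 0 = n -> (forall v, arr s 3 v = F v) ->
  runs M (select k) s (fun s' =>
    (exists a, [/\ a <= n, reg s' (10 + k) = a, reg s' (15 + k) = F a,
       forall v, v < n -> F v <= F a &
       forall v, arr s' 3 v = if v == a then 0 else F v]) /\
    untouched (select k) s s').
Proof.
move=> nM s0 s3; apply: runs_untouched; have M0 : 0 < M by lia.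
apply: (runs_seq (Q := fun s' => s' = set_reg s 5 n)).
  by apply: runs_straight => //=; rewrite s0.
move=> _ ->; apply: runs_seq.
  apply: (@runs_for_vertices _ _ n _ (fun i s' =>
    reg s' 5 <= n /\ forall v, v < i -> F v <= F (reg s' 5))) => //.
  move=> i s' ilt s'x [rs as_] [le Ii].
  have s'F v : arr s' 3 v = F v by rewrite as_ //= s3.
  rewrite /= !s'F s'x; case: ifP => /= lt; split=> //.
  - exact: ltnW.
  - move=> v; rewrite ltnS leq_eqVlt => /orP[/eqP-> //|/Ii]; lia.
  - move=> v; rewrite ltnS leq_eqVlt => /orP[/eqP-> //|/Ii //]; lia.
move=> s1 [[le max] [rs as_]].
have s1F v : arr s1 3 v = F v by rewrite as_ //= s3.
apply: runs_straight => //=.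
exists (reg s1 5); split=> //=.
- by rewrite eqn_add2r /= eqxx.
- by rewrite eqxx /= -s1F.
- by move=> v; rewrite s1F.
Qed.

(** The keys seen by the selection number [i], where [l] lists the selected vertices
    in their order. *)
Definition residue (F : nat -> nat) (l : seq nat) (i v : nat) : nat :=
  if v \in take i l then 0 else F v.

Fixpoint select_first (m : nat) : cmd :=
  if m is m'.+1 then select_first m';; select m' else Skip.

Definition ranking (n : nat) (F : nat -> nat) (l : seq nat) : Prop :=
  forall i, i < size l -> nth 0 l i <= n /\
    forall v, v < n -> residue F l i v <= residue F l i (nth 0 l i).

Lemma runs_select_first M m n s (F : nat -> nat) :
  m <= 5 -> n < M -> reg s 0 = n -> (forall v, arr s 3 v = F v) ->
  runs M (select_first m) s (fun s' =>
    (exists l, [/\ size l = m, ranking n F l,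
       forall i, i < m -> reg s' (10 + i) = nth 0 l i /\
         reg s' (15 + i) = residue F l i (nth 0 l i) &
       forall v, arr s' 3 v = residue F l m v]) /\
    untouched (select_first m) s s').
Proof.
move=> m5 nM s0 s3; apply: runs_untouched; have M0 : 0 < M by lia.
elim: m m5 => [|m IH] m5; first by apply: runs_straight => //; exists [::].
have r0 k : 0 \notin written_regs (select_first k).
  by elim: k => //= k; rewrite mem_cat => /negPf->.
apply: runs_seq; first by apply: runs_untouched; apply: IH; lia.
move=> s1 [[l [sl rl regs a3]] [rs as_]].
apply: runs_weaken.
  by apply: (@runs_select M m n s1 (residue F l m)) => //; rewrite rs.
move=> s2 [[a [an ra rd max a3']] [rs' _]]; exists (rcons l a).
have tk i : i <= m -> take i (rcons l a) = take i l.
  by move=> im; rewrite -cats1 takel_cat ?sl.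
split.
- by rewrite size_rcons sl.
- move=> i; rewrite size_rcons sl ltnS => im.
  rewrite nth_rcons sl /residue (tk _ im).
  case: ltnP => lt; first by apply: rl; rewrite sl.
  by have -> : i = m by [lia]; rewrite eqxx.
- move=> i; rewrite ltnS => im; rewrite nth_rcons sl /residue (tk _ im).
  case: ltnP => lt.
    have [r1 r2] := regs i lt.
    by rewrite !rs' //= !inE; rewrite -?r1 -?r2; lia.
  by have -> : i = m by [lia]; rewrite eqxx.
- move=> v; rewrite a3' /residue !take_oversize ?size_rcons ?sl //.
  by rewrite mem_rcons inE; case: eqP.
Qed.

Lemma ranking_bound n F l i v : ranking n F l -> i < size l -> v < n ->
  v \notin take i l -> F v <= residue F l i (nth 0 l i).
Proof.
by move=> rk il vn /negPf vl; have [_ /(_ v vn)] := rk i il; rewrite {1}/residue vl.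
Qed.

(** A positive residual key shows that none of the selections so far has been
    void; and the keys of the selected vertices never increase. *)
Lemma ranking_prefix n F l i : ranking n F l -> F n = 0 -> i < size l ->
  0 < residue F l i (nth 0 l i) ->
  [/\ all (fun v => v < n) (take i.+1 l), uniq (take i.+1 l) &
      forall v, v \in take i.+1 l -> residue F l i (nth 0 l i) <= F v].
Proof.
move=> rk Fn il pos.
set d := residue _ _ _ _ in pos *.
have lin : nth 0 l i < n.
  have [le _] := rk i il; rewrite ltn_neqAle le andbT.
  by apply: contraTneq pos => ln; rewrite /d /residue ln Fn if_same.
have step j : j <= i -> [/\ nth 0 l j < n, nth 0 l j \notin take j l & d <= F (nth 0 l j)].
  move=> ji; have jl : j < size l by lia.
  have [le max] := rk j jl.
  have dj : d <= residue F l j (nth 0 l j).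
    apply: leq_trans (max _ lin); rewrite /d /residue.
    case: ifP => // nin; case: ifP => // nin'.
    by rewrite -(take_takel _ ji) in nin'; rewrite (mem_take nin') in nin.
  move: (leq_trans pos dj); rewrite /residue; case: ifP => // nin Fpos.
  split=> //; last by move: dj; rewrite /residue nin.
  rewrite ltn_neqAle le andbT; apply: contraTneq Fpos => ->.
  by rewrite Fn.
have : forall k, k <= i.+1 -> [/\ all (fun v => v < n) (take k l), uniq (take k l) &
      forall v, v \in take k l -> d <= F v].
  elim=> [|k IH] ki; first by rewrite take0.
  have [ln nin dF] := step k ki; have [al ul dl] := IH (ltnW ki).
  rewrite (take_nth 0) ?(leq_trans ki) // all_rcons rcons_uniq ln nin; split=> // v.
  by rewrite mem_rcons inE => /orP[/eqP->|/dl].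
by apply.
Qed.

(** * Coding the vertices by their adjacency to the core *)

Definition add_bit (k : nat) : cmd :=
  Assign 3 (Get 0 (Var (10 + k)));; Assign 4 (Get 0 (Succ (Var (10 + k))));;
  upto 3 4 (Put 4 (Get 1 (Var 3)) (iter (2 ^ k) Succ (Get 4 (Get 1 (Var 3))))).

Lemma eval_iter_Succ s m x : eval s (iter m Succ x) = m + eval s x.
Proof. by elim: m => //= m ->. Qed.

(** The adjacency list of [a] has no repetition, so every neighbor gets the
    contribution [2 ^ k] once. *)
Lemma runs_add_bit M k n (e : rel 'I_n) adj s (a : 'I_n) (F : nat -> nat) :
  adjacency_lists e adj -> n < M -> holds_graph adj s -> reg s (10 + k) = a ->
  (forall w, arr s 4 w = F w) ->
  runs M (add_bit k) s (fun s' =>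
    (forall w : 'I_n, arr s' 4 w = F w + 2 ^ k * e a w) /\
    untouched (add_bit k) s s').
Proof.
move=> adjE nM [s0 off s1] sa s4; apply: runs_untouched.
have M0 : 0 < M by lia.
pose lo := offset adj a; pose hi := lo + size (adj a).
pose s2 := set_reg (set_reg s 3 lo) 4 hi.
apply: (runs_seq (Q := fun s' => s' = set_reg s 3 lo)).
  by apply: runs_straight => //=; rewrite sa off // ltnW.
move=> _ ->; apply: (runs_seq (Q := fun s' => s' = s2)).
  by apply: runs_straight => //=; rewrite sa off // offsetS.
move=> _ ->; set body := Put _ _ _.
pose seg := [seq val w | w <- adj a].
have sseg : size seg = size (adj a) by rewrite size_map.
have sadj : size (adj a) <= n.
  by have [/card_uniqP<- _] := adjE a; rewrite -[leqRHS](card_ord n) max_card.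
apply: (runs_weaken (Q := fun s' => (forall w, arr s' 4 w =
   F w + 2 ^ k * count_mem w (take (hi - lo) seg)) /\ untouched (upto 3 4 body) s2 s')).
  apply: (@runs_for _ 3 4 body lo hi s2
    (fun i s' => forall w, arr s' 4 w = F w + 2 ^ k * count_mem w (take (i - lo) seg))) => //.
  - exact: leq_addr.
  - by rewrite /hi; lia.
  - by move=> w; rewrite subnn take0 muln0 addn0 /= s4.
  move=> i s' ibnd s'3 [_ as_] Ii w.
  have ilt : i - lo < size seg by rewrite sseg; move: ibnd; rewrite /hi; lia.
  have si : i = lo + (i - lo) by lia.
  have e1 : arr s' 1 (reg s' 3) = nth 0 seg (i - lo).
    by rewrite s'3 as_ //= s1 {1}si nth_flatten_lists // -sseg.
  have -> : i.+1 - lo = (i - lo).+1 by lia.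
  rewrite (take_nth 0 ilt) -cats1 count_cat /= eval_iter_Succ /= e1 !Ii addn0.
  rewrite [nth 0 seg _ == w]eq_sym; case: eqP => [->|_] /=; last by rewrite addn0.
  by rewrite mulnDr muln1 addnCA (addnC (2 ^ k)).
move=> s' [h _] w; rewrite h /hi addKn -sseg take_size /seg.
by rewrite (count_adjacency a w adjE).
Qed.

(** The core vertices see one another, so their sums of digits are
    overwritten by their own codes. *)
Definition encode : cmd :=
  add_bit 0;; add_bit 1;; add_bit 2;; add_bit 3;;
  Put 4 (Var 10) (Const 16);; Put 4 (Var 11) (Const 17);;
  Put 4 (Var 12) (Const 18);; Put 4 (Var 13) (Const 19).

Definition code n (e : rel 'I_n) (a : nat -> 'I_n) (w : 'I_n) : nat :=
  if w == a 3 then 19 else if w == a 2 then 18 else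
  if w == a 1 then 17 else if w == a 0 then 16 else
  e (a 0) w + 2 * e (a 1) w + 4 * e (a 2) w + 8 * e (a 3) w.

Lemma runs_encode M n (e : rel 'I_n) adj s (a : nat -> 'I_n) :
  adjacency_lists e adj -> n < M -> holds_graph adj s ->
  (forall k, k < 4 -> reg s (10 + k) = a k) -> (forall w, arr s 4 w = 0) ->
  runs M encode s (fun s' =>
    (forall w : 'I_n, arr s' 4 w = code e a w) /\ untouched encode s s').
Proof.
move=> adjE nM gs sa s4; apply: runs_untouched; have M0 : 0 < M by lia.
have stage k F s1 : k < 4 -> holds_graph adj s1 ->
    (forall k, k < 4 -> reg s1 (10 + k) = a k) ->
    (forall w : 'I_n, arr s1 4 w = F w) ->
    runs M (add_bit k) s1 (fun s2 => [/\ holds_graph adj s2,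
      forall k, k < 4 -> reg s2 (10 + k) = a k &
      forall w : 'I_n, arr s2 4 w = F w + 2 ^ k * e (a k) w]).
  move=> k4 gs1 sa1 s14.
  apply: runs_weaken.
    by apply: (@runs_add_bit M k n e adj s1 (a k) (arr s1 4)) => //; exact: sa1.
  move=> s2 [h unt]; split; first exact: holds_graph_untouched unt gs1.
    by case: unt => rs _ j j4; rewrite rs ?sa1 //= !inE; lia.
  by move=> w; rewrite h s14.
apply: runs_seq; first by apply: (stage 0 (fun=> 0)) => // w; rewrite s4.
move=> s1 [g1 r1 a1]; apply: runs_seq; first exact: stage a1.
move=> s2 [g2 r2 a2]; apply: runs_seq; first exact: stage a2.
move=> s3 [g3 r3 a3]; apply: runs_seq; first exact: stage a3.
move=> s5 [g5 r5 a5]; apply: runs_straight => // w.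
have [q0 q1 q2 q3] := And4 (r5 0 isT) (r5 1 isT) (r5 2 isT) (r5 3 isT).
rewrite /= ?addn0 in q0 q1 q2 q3 *.
rewrite q0 q1 q2 q3 /code -!val_eqE a5; do 4!case: ifP => // _.
by rewrite !expnE /=; lia.
Qed.

Definition core n (a : nat -> 'I_n) : {set 'I_n} := [set a 0; a 1; a 2; a 3].

Variant code_spec n (e : rel 'I_n) (a : nat -> 'I_n) (w : 'I_n) : nat -> bool -> Type :=
  | CodeCore k of k < 4 & w = a k : code_spec e a w (16 + k) true
  | CodeRest (t : nat) of t < 16 & (forall k, k < 4 -> bit k t = e (a k) w) :
      code_spec e a w t false.

Lemma codeP n (e : rel 'I_n) (a : nat -> 'I_n) (w : 'I_n) :
  code_spec e a w (code e a w) (w \in core a).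
Proof.
rewrite /code /core !inE.
have [->|_] := eqVneq w (a 3); first by rewrite orbT; exact: (@CodeCore _ _ _ _ 3).
have [->|_] := eqVneq w (a 2); first by rewrite orbT; exact: (@CodeCore _ _ _ _ 2).
have [->|_] := eqVneq w (a 1); first by rewrite orbT; exact: (@CodeCore _ _ _ _ 1).
have [->|_] := eqVneq w (a 0); first exact: (@CodeCore _ _ _ _ 0).
apply: CodeRest; first by do 4!case: (e _ w).
by case=> [|[|[|[|//]]]] _; do 4!case: (e _ w).
Qed.

(** Adjacency is a function of the codes because the core is a clique and its
    complement is independent. *)
Lemma code_adjE n (e : rel 'I_n) (a : nat -> 'I_n) u v :
  symmetric e -> irreflexive e -> {in gtn 4 &, injective a} ->
  clique e (core a) -> independent e (~: core a) ->
  e u v = code_adj (code e a u) (code e a v).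
Proof.
move=> eC eI inja cA iA; rewrite /code_adj.
have := cA u v; have := iA u v; rewrite !in_setC.
case: (codeP e a u) => [i i4 uE|s s16 sE]; case: (codeP e a v) => [j j4 vE|t t16 tE].
- move=> _ /(_ isT isT) euv; rewrite !leq_addr eqn_add2l.
  have [ij|ij] := eqVneq i j; first by rewrite uE vE ij eI.
  apply: euv; rewrite uE vE; apply: contra ij => /eqP/inja ij.
  by apply/eqP/ij.
- by move=> _ _; rewrite leq_addr [16 <= t]leqNgt t16 /= ?addKn tE // uE.
- by move=> _ _; rewrite leq_addr [16 <= s]leqNgt s16 /= ?addKn sE // eC vE.
- by move=> /(_ isT isT)/negPf-> _; rewrite [16 <= s]leqNgt s16 [16 <= t]leqNgt t16.
Qed.

Lemma code_lt n (e : rel 'I_n) (a : nat -> 'I_n) w : code e a w < 20.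
Proof. by case: codeP => [k k4|t t16] *; lia. Qed.

Lemma code_core n (e : rel 'I_n) (a : nat -> 'I_n) w :
  (w \in core a) = (16 <= code e a w).
Proof. by case: codeP => [k k4 _|t t16 _]; [rewrite ?leq_addr|rewrite leqNgt t16]. Qed.

Lemma code_chosen n (e : rel 'I_n) (a : nat -> 'I_n) k :
  {in gtn 4 &, injective a} -> k < 4 -> code e a (a k) = 16 + k.
Proof.
move=> inja k4; have : a k \in core a.
  by rewrite !inE; case: k k4 => [|[|[|[|]]]] // _; rewrite eqxx ?orbT.
by case: codeP => // j j4 /inja -> .
Qed.

(** Code 15 would mean four neighbors. *)
Lemma code_not_full n (e : rel 'I_n) (a : nat -> 'I_n) w :
  {in gtn 4 &, injective a} -> symmetric e -> #|e w| < 4 -> code e a w != 15.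
Proof.
move=> inja eC; apply: contraTneq; case: codeP => // t _ tE t15.
rewrite t15 in tE; rewrite -leqNgt.
have <- : #|[seq a k | k <- iota 0 4]| = 4.
  apply/card_uniqP; rewrite map_inj_in_uniq // => i j; rewrite !mem_iota; exact: inja.
apply/subset_leq_card/subsetP=> _ /mapP[k + ->]; rewrite mem_iota => k4.
rewrite unfold_in eC -tE //; by case: k k4 => [|[|[|[|]]]].
Qed.

Definition represent : cmd := for_vertices (Put 5 (Get 4 (Var 3)) (Succ (Var 3))).

(** Entries are shifted by 1, since 0 marks the codes that do not occur. *)
Definition represented n (cd : 'I_n -> nat) (s : store) : Prop :=
  forall c, if arr s 5 c is v.+1 then exists2 w : 'I_n, val w = v & cd w = c
            else forall w, cd w != c.

(** The last vertex with a given code is the one that is kept. *)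
Lemma runs_represent M n s (cd : 'I_n -> nat) :
  n < M -> reg s 0 = n -> (forall w : 'I_n, arr s 4 w = cd w) ->
  (forall c, arr s 5 c = 0) ->
  runs M represent s (fun s' => represented cd s' /\ untouched represent s s').
Proof.
move=> nM s0 s4 s5; apply: runs_untouched.
apply: runs_weaken.
  apply: (@runs_for_vertices M _ n s (fun i s' => forall c,
    if arr s' 5 c is v.+1 then exists2 w : 'I_n, val w = v & cd w = c
    else forall w : 'I_n, w < i -> cd w != c)) => //.
    by move=> c /=; rewrite s5.
  move=> i s' ilt s'3 [_ as_] Ii c.
  have s'4 : arr s' 4 i = cd (Ordinal ilt) by rewrite as_ //= -s4.
  rewrite /= s'3 s'4; case: eqP => [->|ci]; first by exists (Ordinal ilt).
  have := Ii c; case: (arr s' 5 c) => // max w.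
  rewrite ltnS leq_eqVlt => /orP[/eqP wi|/max //].
  apply/eqP=> wc; case: ci; rewrite -wc; congr (cd _); exact: val_inj.
move=> s' [h _] c; have := h c; case: (arr s' 5 c) => // max w.
exact: max.
Qed.

(** * Programs that write certificates *)

Definition literal_test (l : literal) : test :=
  let b := Eq (Get 5 (Const l.1)) (Const 0) in if l.2 then Not b else b.

Definition all_literals (m : seq literal) : test :=
  foldr (fun l b => And (literal_test l) b) (Eq (Const 0) (Const 0)) m.

Lemma holds_all_literals s m : holds s (all_literals m) =
  all (fun l : literal => (arr s 5 l.1 != 0) == l.2) m.
Proof. by elim: m => //= -[t []] m ->; rewrite /= ?eqbF_neg ?negbK ?eqb_id. Qed.

Fixpoint puts (a : nat) (F : nat -> expr) (m : nat) : cmd :=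
  if m is m'.+1 then puts a F m';; Put a (Const m') (F m') else Skip.

Lemma straight_puts a F m : straight (puts a F m).
Proof. by elim: m => //= m ->. Qed.

Lemma result_puts a F m s :
  (forall i s i' v, eval (set_arr s a i' v) (F i) = eval s (F i)) ->
  let s' := result (puts a F m) s in
  [/\ reg s' = reg s, forall b i, b != a -> arr s' b i = arr s b i &
      forall i, i < m -> arr s' a i = eval s (F i)].
Proof.
move=> Fa; suff [H E] : let s' := result (puts a F m) s in
  [/\ reg s' = reg s, forall b i, b != a -> arr s' b i = arr s b i &
      forall i, i < m -> arr s' a i = eval s (F i)] /\
  forall i, eval s' (F i) = eval s (F i) by [].
elim: m => [|m [[r b l] ev]] /=; first by [].
split; last by move=> i; rewrite Fa ev.
split=> // [c i /negPf ca|i]; first by rewrite ca b // ca.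
rewrite eqxx /= ltnS leq_eqVlt; case: eqP => [-> _|_ /l //]; exact: ev.
Qed.

(** Writes the representatives of the codes of [L]. *)
Definition emit (L : seq nat) : cmd :=
  Assign 2 (Const (size L));;
  puts 2 (fun i => Pred (Get 5 (Const (nth 0 L i)))) (size L).

Definition emit_chosen : cmd :=
  Assign 2 (Const 5);; puts 2 (fun i => Var (10 + i)) 5.

Definition final_color (o : seq (nat * nat)) (c : nat) : nat :=
  if c < 16 then color_of o c else c - 16.

Definition paint (o : seq (nat * nat)) : cmd :=
  puts 6 (fun c => Const (final_color o c)) 20;;
  Assign 1 (Const 1).

Definition outcome : Type :=
  ((seq (seq nat) * seq nat) + seq (nat * nat))%type.

Definition outcomes : seq outcome :=
  [seq inl (N, t) | N <- configurations, t <- clique_orders] ++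
  [seq inr o | o <- orientations].

Definition evidence (c : outcome) : seq literal :=
  match c with inl p => presence p.1 p.2 | inr o => absence o end.

Definition report (c : outcome) : cmd :=
  match c with inl p => emit (placement p.1 p.2) | inr o => paint o end.

Definition decide : cmd :=
  foldr (fun c P => If (all_literals (evidence c)) (report c) P) Skip outcomes.

Lemma straight_decide : straight decide.
Proof.
by rewrite /decide; elim: outcomes => //= -[p|o] l ->; rewrite /= ?straight_puts.
Qed.

Variant decide_spec (s : store) : store -> Prop :=
  | DecideNo N t of N \in configurations & t \in clique_orders
      & all (fun l : literal => (arr s 5 l.1 != 0) == l.2) (presence N t) :
      decide_spec s (result (emit (placement N t)) s)
  | DecideYes o of o \in orientations
      & all (fun l : literal => (arr s 5 l.1 != 0) == l.2) (absence o) :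
      decide_spec s (result (paint o) s).

Lemma decideP s : decide_spec s (result decide s).
Proof.
set sat := all (fun l : literal => (arr s 5 l.1 != 0) == l.2).
have : has (fun c => sat (evidence c)) outcomes.
  have := obstruction_or_orientation (fun t => arr s 5 t != 0).
  rewrite has_cat -/sat => some; rewrite /outcomes has_cat.
  case/orP: some => /hasP[m min satm]; apply/orP; [left|right].
    case/allpairsP: min satm => -[N t] [Nin tin ->] satm; apply/hasP.
    exists (inl (N, t)) => //.
    by apply: (allpairs_f (fun N t => inl (N, t) : outcome)).
  case/mapP: min satm => o oin -> satm; apply/hasP.
  by exists (inr o) => //; apply: (map_f (fun o => inr o : outcome)).
move=> some; have [c [cin satc ->]] : exists c,
    [/\ c \in outcomes, sat (evidence c) & result decide s = result (report c) s].
  rewrite /decide; elim: outcomes some => //= c l IH; rewrite holds_all_literals -/sat.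
  case: ifP => [satc _|_ /IH[c' [cin satc ->]]]; [exists c|exists c'];
    by rewrite inE ?eqxx ?cin ?orbT.
move: cin satc; rewrite /outcomes mem_cat.
case/orP=> [/allpairsP[[N t] [Nin tin ->]]|/mapP[o oin ->]].
  exact: DecideNo.
exact: DecideYes.
Qed.

(** * Correctness of the answers *)

(** An injective table of vertices is a repetition-free list of its image. *)
Lemma listed_certificate n (e : rel 'I_n) s m (r : 'I_m -> 'I_n) :
  reg s 2 = m -> (forall i : 'I_m, arr s 2 i = r i) -> injective r ->
  forbidden e (r @: setT) -> no_certificate e s.
Proof.
move=> sm sr injr forb; exists (r @: setT) => //.
have -> : mkseq (arr s 2) (reg s 2) = [seq val (r i) | i <- enum 'I_m].
  rewrite sm /mkseq -val_enum_ord -map_comp; apply: eq_map => i /=; exact: sr.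
rewrite map_comp; apply: perm_map; apply: uniq_perm.
- by rewrite map_inj_uniq ?enum_uniq.
- exact: enum_uniq.
- move=> v; rewrite mem_enum; apply/mapP/imsetP=> -[i _ ->]; exists i => //.
  by rewrite mem_enum.
Qed.

Lemma certified_no n (e : rel 'I_n) s :
  answer s = 0 -> no_certificate e s -> certified_answer e s.
Proof.
move=> ans cert; right; split=> //; case: cert => W /forbidden_not_colorable; by [].
Qed.

Lemma certified_yes n (e : rel 'I_n) s (f : 'I_n -> 'I_4) :
  answer s = 1 -> star_coloring e f -> (forall v : 'I_n, arr s 2 v = f v) ->
  certified_answer e s.
Proof. by move=> ans sc sf; left; split=> //; exists f. Qed.

Definition color_easily : cmd :=
  for_vertices (Put 2 (Var 3) (Const 3));;
  Put 2 (Var 12) (Const 2);; Put 2 (Var 11) (Const 1);;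
  Put 2 (Var 10) (Const 0);; Assign 1 (Const 1).

(** The registers may name a missing vertex [n], or even coincide: only the
    set of the vertices they name matters. *)
Lemma runs_color_easily M n (e : rel 'I_n) s :
  irreflexive e -> n < M -> reg s 0 = n ->
  independent e (~: [set v : 'I_n | val v \in [:: reg s 10; reg s 11; reg s 12]]) ->
  runs M color_easily s (certified_answer e).
Proof.
move=> eI nM sn; set x0 := reg s 10; set x1 := reg s 11; set x2 := reg s 12 => iS.
have M0 : 0 < M by lia.
apply: runs_seq.
  apply: (@runs_for_vertices _ _ n _ (fun i s' => forall v, v < i -> arr s' 2 v = 3)) => //.
  move=> i s' _ s'3 _ Ii v /=; rewrite s'3 ltnS leq_eqVlt.
  by case: eqP => //= _ /Ii.
move=> s1 [s12 [rs _]]; apply: runs_straight => //.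
pose f (v : 'I_n) : 'I_4 := inord (if val v == x0 then 0 else if val v == x1 then 1
  else if val v == x2 then 2 else 3).
have fE (v : 'I_n) : f v = (if val v == x0 then 0 else if val v == x1 then 1
  else if val v == x2 then 2 else 3) :> nat.
  by rewrite inordK //; do 3!case: ifP => // _.
have inK (v : 'I_n) : (val v \in [:: x0; x1; x2]) = (f v < 3).
  by rewrite fE !inE; do 3!case: eqP.
have injf (u v : 'I_n) : f u = f v -> f u < 3 -> u = v.
  move/(congr1 val); rewrite /= !fE => uv u3; apply: val_inj; move: uv u3.
  case: (val u =P x0) => [->|_]; last case: (val u =P x1) => [->|_];
    last case: (val u =P x2) => [->|_] //;
    by case: (val v =P x0) => [-> //|_]; case: (val v =P x1) => [-> //|_];
       case: (val v =P x2) => [-> //|_].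
apply: (@certified_yes _ _ _ f) => //; last first.
  move=> v; rewrite fE /= !rs //; do 3!case: eqP => //= _.
  exact: s12.
apply: (star_coloring_from_core iS).
- move=> u v; rewrite !in_set !inK => u3 _ fuv; exact: injf.
- move=> u v euv; apply/eqP=> fuv.
  case: (ltnP (f u) 3) => u3.
    by move: euv; rewrite (injf u v fuv u3) eI.
  move: (iS u v); rewrite !in_setC !in_set !inK -fuv ltnNge u3 /= euv => /(_ isT isT).
  by [].
- move=> u x y w; rewrite !in_set !inK => u3 _ x3 _ _ _ fux _.
  by rewrite fux x3 in u3.
Qed.

Definition color_vertices : cmd := for_vertices (Put 2 (Var 3) (Get 6 (Get 4 (Var 3)))).

Definition resolve : cmd :=
  encode;; represent;; decide;; If (Eq (Var 1) (Const 1)) color_vertices Skip.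

(** A bicolored path would give two opposite arcs of the orientation. *)
Lemma star_coloring_of_orientation n (e : rel 'I_n) (a : nat -> 'I_n) o
    (f : 'I_n -> 'I_4) :
  symmetric e -> irreflexive e -> independent e (~: core a) ->
  o \in orientations -> (forall v, f v = final_color o (code e a v) :> nat) ->
  star_coloring e f.
Proof.
move=> eC eI iS oin fE.
have fcore v : v \in core a -> f v < 4 /\ v = a (f v).
  have := fE v; rewrite /final_color; case: (codeP e a v) => // k k4 vE.
  by rewrite ltnNge leq_addr /= addKn => ->.
have frest v : v \notin core a -> exists2 t, f v = color_of o t :> nat &
    forall k, k < 4 -> bit k t = e (a k) v.
  have := fE v; rewrite /final_color; case: (codeP e a v) => // t t16 tE.
  by rewrite t16; exists t.
have arcs u w : u \notin core a -> w \notin core a ->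
    e (a (f w)) u -> e (a (f u)) w -> False.
  move=> /frest[t ut tE] /frest[t' wt tE'] eu ew.
  apply: (@color_of_clash o t t' oin); rewrite -?ut -?wt ?ltn_ord //.
    by rewrite tE.
  by rewrite tE'.
apply: (star_coloring_from_core iS).
- move=> u v /fcore[_ {2}->] /fcore[_ {2}->] ->; by [].
- move=> u v euv; apply/eqP=> fuv.
  wlog: u v euv fuv / u \notin core a => [IH|uS].
    case uK: (u \in core a); last by apply: (IH u v); rewrite ?uK.
    case vK: (v \in core a); last by apply: (IH v u); rewrite ?vK // eC.
    have [_ uE] := fcore u uK; have [_ vE] := fcore v vK.
    by move: euv; rewrite uE vE fuv eI.
  case vK: (v \in core a).
    have [_ vE] := fcore v vK.
    by apply: (arcs u u); rewrite // fuv -vE eC.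
  by have := iS u v; rewrite !in_setC uS vK euv => /(_ isT isT).
- move=> u x y w uS wS /fcore[_ xE] /fcore[_ yE] euy exw fux fwy.
  by apply: (arcs u w); rewrite // ?fwy -?yE ?fux -?xE // eC.
Qed.

(** * The algorithm *)

(** Every code of the placement occurs: those of core vertices by construction,
    the other ones because the tests succeeded. *)
Lemma emit_certificate n (e : rel 'I_n) (a : nat -> 'I_n) s N t :
  symmetric e -> irreflexive e -> {in gtn 4 &, injective a} ->
  clique e (core a) -> independent e (~: core a) ->
  represented (code e a) s -> N \in configurations -> t \in clique_orders ->
  all (fun l : literal => (arr s 5 l.1 != 0) == l.2) (presence N t) ->
  no_certificate e (result (emit (placement N t)) s).
Proof.
move=> eC eI inja cA iA repr Nin tin pres.
set L := placement N t.
have wp := all_well_placed Nin tin; have /and4P[/eqP sL _ L20 _] := wp.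
have found i : i < size L ->
    exists2 w : 'I_n, code e a w = nth 0 L i & arr s 5 (nth 0 L i) = (val w).+1.
  move=> iL; have := repr (nth 0 L i); case arrL: (arr s 5 _) => [|v]; last first.
    by case=> w <- wE; exists w.
  have [i4|i4] := ltnP i 4.
    have : nth 0 L i - 16 < 4 /\ 16 <= nth 0 L i.
      have st : size t = 4.
        by move: tin; rewrite mem_permutations => /perm_size; rewrite size_iota.
      rewrite /L /placement nth_cat size_map st i4 (nth_map 0) ?st // addKn.
      rewrite leq_addr; split=> //; move: tin; rewrite mem_permutations.
      by move=> /perm_mem/(_ (nth 0 t i)); rewrite mem_nth ?st // mem_iota => /esym.
    move=> [lt le] /(_ (a (nth 0 L i - 16))).
    by rewrite code_chosen // subnKC // eqxx.
  have : (nth 0 L i, true) \in presence N t.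
    have -> : nth 0 L i = nth 0 (drop 4 L) (i - 4) by rewrite nth_drop subnKC.
    by apply/map_f/mem_nth; rewrite size_drop ltn_sub2r // (leq_ltn_trans i4).
  by move/(allP pres); rewrite /= arrL.
have n0 : 0 < n by case: (a 0) => m /=; lia.
pose x0 := Ordinal n0.
pose r (i : 'I_(4 + size N)) : 'I_n := insubd x0 (arr s 5 (nth 0 L i)).-1.
have rE (i : 'I_(4 + size N)) :
    code e a (r i) = nth 0 L i /\ arr s 5 (nth 0 L i) = (val (r i)).+1.
  have [|w we ws] := found i; first by rewrite sL ltn_ord.
  have -> : r i = w by rewrite /r ws /= valKd.
  by split.
have [injr forb] := @forbidden_placement _ e (code e a) N L r
  (fun u v => code_adjE u v eC eI inja cA iA) Nin wp (fun i => (rE i).1).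
apply: (listed_certificate _ _ injr forb).
  by rewrite -sL /=; have [-> _ _] := @result_puts 2
    (fun i => Pred (Get 5 (Const (nth 0 L i)))) (size L)
    (set_reg s 2 (size L)) (fun _ _ _ _ => erefl).
move=> i; rewrite /=; have [_ _ ->] := @result_puts 2
    (fun i => Pred (Get 5 (Const (nth 0 L i)))) (size L)
    (set_reg s 2 (size L)) (fun _ _ _ _ => erefl).
  by rewrite /= (rE i).2.
by rewrite sL.
Qed.

(** Stated for the few cells used later, and proved for tables of any length, so
    that the table of 20 colors is never unfolded. *)
Lemma result_paint o s : let s' := result (paint o) s in
  [/\ reg s' 1 = 1, reg s' 0 = reg s 0, forall i, arr s' 4 i = arr s 4 i &
      forall c, c < 20 -> arr s' 6 c = final_color o c].
Proof.
rewrite /paint; set F := fun c => _; move: 20 => m.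
have [r4 a4 a6] := @result_puts 6 F m s (fun _ _ _ _ => erefl).
by split=> [||i|c cm] //=; [rewrite r4|rewrite a4|rewrite a6].
Qed.

Lemma runs_resolve M n (e : rel 'I_n) adj s (a : nat -> 'I_n) :
  symmetric e -> irreflexive e -> adjacency_lists e adj -> n < M ->
  holds_graph adj s -> (forall k, k < 4 -> reg s (10 + k) = a k) ->
  reg s 1 = 0 -> (forall w, arr s 4 w = 0) -> (forall c, arr s 5 c = 0) ->
  {in gtn 4 &, injective a} -> clique e (core a) -> independent e (~: core a) ->
  (forall v, v \notin core a -> #|e v| < 4) ->
  runs M resolve s (certified_answer e).
Proof.
move=> eC eI adjE nM gs sa sr1 s4 s5 inja cA iA small.
have M0 : 0 < M by lia.
apply: runs_seq; first exact: runs_encode sa s4.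
move=> s1 [s14 unt1]; have g1 : holds_graph adj s1 by apply: holds_graph_untouched unt1 gs.
have [n1 _ _] := g1; case: unt1 => r1 a1.
apply: runs_seq; first by apply: (@runs_represent M n s1 (code e a)) => // c; rewrite a1.
move=> s2 [repr [r2 a2]].
have s24 (w : 'I_n) : arr s2 4 w = code e a w by rewrite a2.
have s21 : reg s2 1 = 0 by rewrite r2 // r1.
have s20 : reg s2 0 = n by rewrite r2.
apply: (runs_seq (Q := fun s' => s' = result decide s2)).
  exact: runs_straight straight_decide _.
move=> _ ->; apply: runs_if => //; case: (decideP s2) => [N t Nin tin pres|o oin none].
  have ans : reg (result (emit (placement N t)) s2) 1 = 0.
    by rewrite /=; have [-> _ _] := @result_puts 2
      (fun i => Pred (Get 5 (Const (nth 0 (placement N t) i)))) (size (placement N t))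
      (set_reg s2 2 (size (placement N t))) (fun _ _ _ _ => erefl).
  have -> : holds (result (emit (placement N t)) s2) (Eq (Var 1) (Const 1)) = false.
    exact: (congr1 (eq_op^~ 1) ans).
  apply: runs_straight => //; apply: certified_no => //.
  exact: (@emit_certificate n e a).
have [s31 s30' s34' s36] := result_paint o s2; move: s31 s30' s34' s36.
move: (result (paint o) s2) => s3 s31 s30' s34' s36.
have -> : holds s3 (Eq (Var 1) (Const 1)) = true by exact: (congr1 (eq_op^~ 1) s31).
have s30 : reg s3 0 = n by rewrite s30'.
have s34 (w : 'I_n) : arr s3 4 w = code e a w by rewrite s34'.
have lt4 w : final_color o (code e a w) < 4.
  rewrite /final_color; have := s24 w; have := code_lt e a w.
  have := code_core e a w; case: (ltnP (code e a w) 16) => [lt nw _ _|ge _ lt _]; last by lia.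
  rewrite ltn_neqAle color_of_le andbT; apply/eqP=> bad.
  have n15 := code_not_full inja eC (small w (negbT nw)).
  have : (code e a w, false) \in absence o.
    by apply: map_f; rewrite mem_filter bad eqxx mem_iota /=; lia.
  move/(allP none); rewrite /= eqbF_neg negbK => /eqP z.
  by have := repr (code e a w); rewrite z => /(_ w); rewrite eqxx.
pose f w : 'I_4 := inord (final_color o (code e a w)).
have fE w : f w = final_color o (code e a w) :> nat by rewrite inordK.
have sc := star_coloring_of_orientation eC eI iA oin fE.
apply: runs_weaken.
  apply: (@runs_for_vertices M _ n s3 (fun i s' =>
    forall w : 'I_n, w < i -> arr s' 2 w = f w)) => //.
  move=> i s' ilt s'x [_ as_] Ii w; rewrite ltnS leq_eqVlt /= s'x.
  case: eqP => [wi _|_ /Ii //].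
  have -> : arr s' 4 i = code e a w by rewrite -wi as_ // s34.
  by rewrite as_ // s36 ?code_lt // fE.
move=> s5' [h [rs _]]; apply: (certified_yes _ sc) => [|v]; last exact: h.
by rewrite /answer rs.
Qed.

Definition test_star_4_colorable : cmd :=
  count_degrees;; select_first 5;;
  If (Lt (Const 4) (Var 19)) emit_chosen
     (If (Lt (Const 3) (Var 18)) resolve color_easily).

Lemma card_listed n (l : seq nat) :
  uniq l -> all (fun v => v < n) l -> #|[set v : 'I_n | val v \in l]| = size l.
Proof.
move=> ul al; have [t tl] : exists t : seq 'I_n, map val t = l.
  elim: l al {ul} => [|v l IH] /=; first by exists [::].
  by case/andP=> vn /IH[t <-]; exists (Ordinal vn :: t).
rewrite -tl cardsE size_map; rewrite -tl (map_inj_uniq val_inj) in ul.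
rewrite -(card_uniqP ul); apply: eq_card => v.
by rewrite [LHS](mem_map val_inj).
Qed.

(** [leading_clique] for the first [k + 1] selected vertices: the key of the last
    one bounds their keys from below. *)
Lemma ranking_clique n (e : rel 'I_n) (F : nat -> nat) l k :
  symmetric e -> irreflexive e -> split_graph e ->
  (forall v : 'I_n, F v = #|e v|.+1) -> F n = 0 -> ranking n F l ->
  k < size l -> k < residue F l k (nth 0 l k) ->
  clique e [set v : 'I_n | val v \in take k.+1 l].
Proof.
move=> eC eI sp FE Fn rk kl kd.
have [al ul dl] := ranking_prefix rk Fn kl (leq_ltn_trans (leq0n k) kd).
apply: (leading_clique eC eI sp) => [a b|a]; rewrite !in_set => /dl; rewrite FE => da.
  move=> bA; rewrite -ltnS -FE; apply: leq_trans da.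
  apply: (ranking_bound rk) => //; apply: contra bA.
  by rewrite -(take_takel _ (leqnSn k)); exact: mem_take.
by rewrite card_listed // size_takel //; apply: leq_trans da.
Qed.

(** [leading_independent] for the first [k + 1] selected vertices: the key of the
    next one bounds all other keys from above. *)
Lemma ranking_independent n (e : rel 'I_n) (F : nat -> nat) l k :
  symmetric e -> irreflexive e -> split_graph e ->
  (forall v : 'I_n, F v = #|e v|.+1) -> F n = 0 -> ranking n F l ->
  k.+1 < size l -> residue F l k.+1 (nth 0 l k.+1) <= k.+1 ->
  independent e (~: [set v : 'I_n | val v \in take k.+1 l]).
Proof.
move=> eC eI sp FE Fn rk kl kd.
have outside (b : 'I_n) : val b \notin take k.+1 l -> val b \notin take k l.
  by apply: contra; rewrite -(take_takel _ (leqnSn k)); exact: mem_take.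
(* If the [k]-th selection is void, all the vertices have been selected before. *)
have [d0|dpos] := posnP (residue F l k (nth 0 l k)).
  move=> u v; rewrite in_setC in_set => /outside ul.
  by have := ranking_bound rk (ltnW kl) (ltn_ord u) ul; rewrite d0 FE.
have [al ul dl] := ranking_prefix rk Fn (ltnW kl) dpos.
apply: (leading_independent eC eI sp) => [a b|b]; rewrite !in_set.
  move/dl; rewrite FE => da /outside bl; rewrite -ltnS -FE; apply: leq_trans da.
  exact: (ranking_bound rk (ltnW kl)).
move=> bl; rewrite card_listed // size_takel ?(ltnW kl) // -FE.
by apply: leq_trans kd; apply: (ranking_bound rk).
Qed.

Lemma runs_linear M N P s (Q : store -> Prop) : M <= 2 * N -> runs M P s Q ->
  exists t s', [/\ exec P s t s', t <= weight P * 2 * N & Q s'].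
Proof.
move=> MN [t [s' [ex le q]]]; exists t, s'; split=> //; apply: leq_trans le _.
by rewrite -mulnA leq_mul2l MN orbT.
Qed.

Theorem corollary3p10 :
  exists (P : cmd) (C : nat),
    forall (n : nat) (e : rel 'I_n) (adj : 'I_n -> seq 'I_n),
      symmetric e -> irreflexive e -> split_graph e ->
      adjacency_lists e adj ->
      exists (t : nat) (s : store),
        [/\ exec P (input adj) t s,
            t <= C * (n + #|edges e|).+1 &
            certified_answer e s].
Proof.
exists test_star_4_colorable, (weight test_star_4_colorable * 2).
move=> n e adj eC eI split adjE.
(* Every loop makes fewer than [M] rounds. *)
pose M := (n + size (flatten (lists_of adj))).+1.
apply: (@runs_linear M); first by have := size_flatten_lists eI adjE; rewrite /M; lia.
have nM : n < M by rewrite /M; lia.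
have M0 : 0 < M by [].
have g0 : holds_graph adj (input adj).
  by split=> // v vn; apply: input_offset.
apply: runs_seq.
  by apply: (@runs_count_degrees M n adj (input adj)) => //; rewrite /M; lia.
move=> s1 [key unt1]; have g1 : holds_graph adj s1 by apply: holds_graph_untouched unt1 g0.
have [n1 _ _] := g1.
apply: runs_seq; first exact: (@runs_select_first M 5 n s1 (rank_key adj)).
move=> s2 [[l [sl rk regs _]] unt2].
have g2 : holds_graph adj s2 by apply: holds_graph_untouched unt2 g1.
have [s20 _ _] := g2.
case: unt1 unt2 => r1 a1 [r2 a2].
have keyE (v : 'I_n) : rank_key adj v = #|e v|.+1.
  by rewrite /rank_key (count_flatten_lists v eC adjE) ltn_ord.
have keyn : rank_key adj n = 0.
  rewrite /rank_key ltnn; apply/count_memPn/flattenP=> -[_ /mapP[v _ ->]].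
  by case/mapP=> u _ nu; have := ltn_ord u; rewrite -nu ltnn.

(* From here on the five selected vertices are named. *)
case: l sl rk regs => [|v0 [|v1 [|v2 [|v3 [|v4 [|]]]]]] // _ rk regs.
set l := [:: v0; v1; v2; v3; v4] in rk regs *.
have chosen k : k < 5 -> k < residue (rank_key adj) l k (nth 0 l k) ->
    exists2 a : nat -> 'I_n, forall i, i <= k -> a i = nth 0 l i :> nat &
    {in gtn k.+1 &, injective a}.
  move=> k5 kd.
  have [al ul _] := ranking_prefix rk keyn k5 (leq_ltn_trans (leq0n k) kd).
  have nth_take i : i <= k -> nth 0 l i = nth 0 (take k.+1 l) i by move=> ik; rewrite nth_take.
  have st : size (take k.+1 l) = k.+1 by rewrite size_takel.
  have lt i : i <= k -> nth 0 l i < n.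
    by move=> ik; rewrite nth_take //; apply: (allP al); rewrite mem_nth // st.
  pose a i : 'I_n := insubd (Ordinal (lt 0 isT)) (nth 0 l i).
  have aE i : i <= k -> a i = nth 0 l i :> nat.
    by move=> ik; rewrite /a val_insubd lt.
  exists a => // i j; rewrite !inE !ltnS => ik jk /(congr1 val) /=.
  rewrite !aE // !nth_take // => /eqP; rewrite nth_uniq ?st // => /eqP; by [].
have d k : k < 5 -> reg s2 (15 + k) = residue (rank_key adj) l k (nth 0 l k).
  by move=> /regs[].
apply: runs_if => //.
have -> : holds s2 (Lt (Const 4) (Var 19)) = (4 < reg s2 (15 + 4)) by [].
rewrite d //; case: ifP => [d4|/negbT]; last rewrite -leqNgt => d4.
  have [a aE inja] := chosen 4 isT d4.
  pose r (i : 'I_5) := a i.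
  have injr : injective r.
    by move=> i j /inja; rewrite !inE !ltn_ord => /(_ isT isT) /val_inj.
  have cl := @ranking_clique _ _ _ _ 4 eC eI split keyE keyn rk isT d4.
  have rin i : r i \in [set v : 'I_n | val v \in take 5 l].
    by rewrite in_set /r /= aE ?mem_nth // -ltnS.
  apply: runs_straight => //; apply: certified_no; first by rewrite /answer /= r2 // r1.
  apply: (@listed_certificate _ _ _ 5 r) => //.
    move=> i; have [_ _ ->] := @result_puts 2 (fun i => Var (10 + i)) 5
      (set_reg s2 2 5) (fun _ _ _ _ => erefl); last exact: ltn_ord.
    have [ri _] := regs i (ltn_ord i).
    by rewrite /r aE -?ri // -[i <= 4]ltnS.
  left; apply: isomorphic_image => // i j; rewrite /complete.
  have [->|ij] := eqVneq i j; first by rewrite eI.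
  by apply: cl => //; apply: contra ij => /eqP/injr->.
apply: runs_if => //.
have -> : holds s2 (Lt (Const 3) (Var 18)) = (3 < reg s2 (15 + 3)) by [].
rewrite d //; case: ifP => [d3|/negbT]; last rewrite -leqNgt => d3.
  have [a aE inja] := chosen 3 isT d3.
  have coreE : core a = [set v : 'I_n | val v \in take 4 l].
    by apply/setP=> v; rewrite !inE -!val_eqE /= !aE // -!orbA.
  apply: (@runs_resolve M n e adj s2 a) => //.
  - by move=> k k4; have [-> _] := regs k (ltnW k4); rewrite aE.
  - by rewrite r2 // r1.
  - by move=> v; rewrite a2 // a1.
  - by move=> v; rewrite a2 // a1.
  - rewrite coreE; exact: (@ranking_clique _ _ _ _ 3 eC eI split keyE keyn rk isT d3).
  - rewrite coreE; exact: (@ranking_independent _ _ _ _ 3 eC eI split keyE keyn rk isT d4).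
  move=> v; rewrite coreE in_set => vl; apply: leq_trans d4; rewrite -keyE.
  exact: (ranking_bound rk).
apply: runs_color_easily => //.
have [-> _] := regs 0 isT; have [-> _] := regs 1 isT; have [-> _] := regs 2 isT.
exact: (@ranking_independent _ _ _ _ 2 eC eI split keyE keyn rk isT d3).
Qed.
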